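(* Let $L/K$ be a Galois extension of algebraic number fields of possibly infinite degree (algebraic extensions of $\mathbb{Q}$), with $L$ Galois over $\mathbb{Q}$. Then there is a group isomorphism $${\sf Gal}\big({\sf N}_\bullet[L]/{\sf N}_\bullet[K]\big)\cong{\sf Gal}(L/K),$$ where ${\sf Gal}({\sf N}_\bullet[L]/{\sf N}_\bullet[K])$ is the group of nonlinear automorphisms of ${\sf N}_\bullet[L]$ fixing ${\sf N}_\bullet[K]$.
   Context: **Hilbert space.** For a finite extension $L/\mathbb{Q}$ let $\mathbb{S}_L=\mathbb{A}_L/(L,+)$ be the adele class group; for $L/\mathbb{Q}$ infinite algebraic, let $\mathbb{S}_L$ denote here the inverse limit of the groups $\mathbb{A}_{L'}/(L',+)$ over finite subextensions $L'\subset L$ along the maps induced by the field traces. It is a compact abelian group with unit mass Haar measure, and its characters $\phi_\alpha$ are canonically indexed by $\alpha\in L$ with $\phi_{\alpha}\phi_{\beta}=\phi_{\alpha+\beta}$. Every $f\in L^2(\mathbb{S}_L,\mathbb{C})$ is $f=\sum_{\alpha\in L}a_\alpha\phi_\alpha$ with $(a_\alpha)\in\ell^2(L)$. The Hilbert space ${\sf H}_\bullet[L]$ of graded-holomorphic functions is identified isometrically, by taking boundary values, with $L^2(\mathbb{S}_L,\mathbb{C})\cong \ell^2(L)$; its elements are written $F=\sum_{\alpha\in L}a_\alpha\boldsymbol\varrho^\alpha$, where the monomial $\boldsymbol\varrho^\alpha$ has boundary value $\phi_\alpha$, and $\|F\|^2=\sum|a_\alpha|^2$. **Grading.** A field $L$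 Galois over $\mathbb{Q}$ is totally real or totally complex. If it is totally real, the sign of $\alpha\in L\setminus\{0\}$ is the vector of signs $\pm$ of its images under the real places. If it is totally complex, choose one embedding $\mu$ from each complex conjugate pair of embeddings; the sign of $\alpha\ne0$ is the vector, indexed by the chosen $\mu$, recording which of the following eight pieces of $\mathbb{C}\setminus\{0\}$ contains $\mu(\alpha)$: the four open half-axes $\mathbb{R}_+, i\mathbb{R}_+,-\mathbb{R}_+,-i\mathbb{R}_+$ or the four open quadrants. Let $\mho_L$ be the set of sign vectors (in the complex case, those realized by elements of $L$), $L^{\boldsymbol\vartheta}$ the set of $\alpha\in L\setminus\{0\}$ of sign $\boldsymbol\vartheta$, and ${\sf H}_{\boldsymbol\vartheta}[L]\subset{\sf H}_\bullet[L]$ the closed subspace of series supported on $L^{\boldsymbol\vartheta}$. Then ${\sf H}_\bullet[L]=\big(\bigoplus_{\boldsymbol\vartheta\in\mho_L}{\sf H}_{\boldsymbol\vartheta}[L]\big)\oplus\mathbb{C}$, the last summand being the constants $\mathbb{C}\boldsymbol\varrho^0$. **Products.** For $F=\sum a_\alpha\boldsymbol\varrho^\alpha$, $G=\sum b_\alpha\boldsymbol\varrho^\alpha$: the Cauchy product is $F\oplus G=\sum_\alpha\big(\sum_{\alpha_1+\alpha_2=\alpha}a_{\alpha_1}b_{\alpha_2}\big)\boldsymbol\varrho^\alpha$, defined when the coefficient sequence lies in $\ell^2(L)$. The Dirichlet product is $F\otimes G=\sum_\alpha d_\alpha\boldsymbol\varrho^\alpha$, $d_\alpha=\sum_{\alpha_1\alpha_2=\alpha}a_{\alpha_1}b_{\alpha_2}$,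 defined when the expression $d_0=a_0\sum_{\alpha\neq0}b_\alpha+b_0\sum_{\alpha\ne0}a_\alpha+a_0b_0$ converges absolutely and $(d_\alpha)\in\ell^2(L)$. **Nonlinear field.** Let ${\sf I}_L\subset{\sf H}_\bullet[L]$ be the set of $F$ with $(a_\alpha)$ absolutely summable and $\sum a_\alpha=0$. Set ${\sf N}_\bullet[L]=({\sf H}_\bullet[L]\setminus{\sf I}_L)/\mathbb{C}^*$, a subset of the full projectivization $\bar{\sf N}_\bullet[L]=\mathbb{P}{\sf H}_\bullet[L]$. It inherits $\oplus$ and $\otimes$ as partially defined operations (on classes $[F]$). For a subfield $K\subset L$, ${\sf N}_\bullet[K]$ is regarded as the subset of ${\sf N}_\bullet[L]$ of classes of series supported on $K$. **Automorphisms.** $\bar{\sf N}_\bullet[L]$ carries the Fubini–Study metric of the inner product. A *nonlinear automorphism* $\Upsilon:{\sf N}_\bullet[L]\to{\sf N}_\bullet[L]$ is the restriction of a bijective Fubini–Study isometry of $\bar{\sf N}_\bullet[L]$ which is graded, i.e. for some permutation $\iota$ of $\mho_L$ one has $\Upsilon(\mathbb{P}{\sf H}_{\boldsymbol\vartheta}[L])=\mathbb{P}{\sf H}_{\iota(\boldsymbol\vartheta)}[L]$ for all $\boldsymbol\vartheta$, and such that $\Upsilon([F]\oplus[G])=\Upsilon([F])\oplus\Upsilon([G])$ and $\Upsilon([F]\otimes[G])=\Upsilon([F])\otimes\Upsilon([G])$ whenever the operations are defined. ${\sf Gal}({\sf N}_\bullet[L]/{\sf N}_\bullet[K])$ is the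 group of nonlinear automorphisms of ${\sf N}_\bullet[L]$ fixing every element of ${\sf N}_\bullet[K]$. *)

(* Defs.v *)
From HB Require Import structures.
From mathcomp Require Import all_boot all_order all_algebra all_field.
From mathcomp Require Import complex.
From mathcomp Require Import all_classical all_reals all_analysis.

Set Implicit Arguments.
Unset Strict Implicit.
Unset Printing Implicit Defensive.

Import Order.TTheory GRing.Theory Num.Theory.
Import Normc.

Local Open Scope classical_set_scope.
Local Open Scope ring_scope.

Section Groups.

(* Groups are given as sets of self-maps of a type, under composition. *)
Definition transformation_group (X : Type) (G : set (X -> X)) : Prop :=
  [/\ G id,
      forall f g, G f -> G g -> G (f \o g)
    & forall f, G f -> exists2 g, G g & f \o g = id /\ g \o f = id].

Definition group_isomorphic (X Y : Type) (G : set (X -> X)) (H : set (Y -> Y)) :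
    Prop :=
  [/\ transformation_group G, transformation_group H
    & exists Phi : (X -> X) -> (Y -> Y),
        set_bij G H Phi /\
        forall f g, G f -> G g -> Phi (f \o g) = Phi f \o Phi g].

End Groups.

Section GaloisExtensions.
Variables (F E : fieldType) (j : {rmorphism F -> E}).

Definition algebraic_ext : Prop := forall x : E, algebraicOver j x.

Definition normal_ext : Prop :=
  forall (p : {poly F}) (x : E), irreducible_poly p -> root (map_poly j p) x ->
  exists s : seq E, map_poly j p %= \prod_(y <- s) ('X - y%:P).

Definition separable_ext : Prop :=
  forall (p : {poly F}) (x : E), irreducible_poly p -> root (map_poly j p) x ->
  separable_poly p.

(* The degree is not assumed to be finite. *)
Definition galois_ext : Prop := [/\ algebraic_ext, normal_ext & separable_ext].

Definition galois_group : set (E -> E) :=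
  [set s | exists f : {rmorphism E -> E},
     [/\ s = f :> (E -> E), bijective f & forall x, f (j x) = j x]].

End GaloisExtensions.

Section Sums.
Variables (R : realType) (I : choiceType).

Definition abs_summable (f : I -> R[i]) : Prop :=
  summable [set: I] (fun i => (normc (f i))%:E).

(* The sum of an absolutely summable family; meaningless otherwise. *)
Definition rsum (f : I -> R) : R :=
  fine (\esum_(i in [set: I]) (f^\+ i)%:E)
  - fine (\esum_(i in [set: I]) (f^\- i)%:E).

Definition csum (f : I -> R[i]) : R[i] :=
  Complex (rsum (fun i => complex.Re (f i))) (rsum (fun i => complex.Im (f i))).

End Sums.

Section NonlinearField.
Variables (R : realType) (L : fieldType).
Local Notation C := R[i].

(* The coefficient family a stands for the series \sum_x (a x) rho^x, where the
   monomial rho^x has boundary value the character phi_x of the adele class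
   group S_L; Hilb is thus L^2(S_L) = l^2(L) in the orthonormal basis phi_x. *)
Definition fseries := L -> C.

Definition Hilb : set fseries :=
  [set a | summable [set: L] (fun x => (normc (a x) ^+ 2)%:E)].

Definition inner (a b : fseries) : C := csum (fun x => a x * conjc (b x)).

Definition hnorm (a : fseries) : R :=
  Num.sqrt (fine (\esum_(x in [set: L]) (normc (a x) ^+ 2)%:E)).

(* All these families are absolutely summable when a and b are in Hilb. *)
Definition cauchy_prod (a b : fseries) : fseries := fun z =>
  csum (fun p : {p : L * L | p.1 + p.2 == z} => a (val p).1 * b (val p).2).

Definition cauchy_defined (a b : fseries) : Prop := Hilb (cauchy_prod a b).

(* For z != 0 the family is absolutely summable when a and b are in Hilb.  For
   z = 0 the pairs with product 0 are (0, y), (x, 0) and (0, 0). *)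
Definition dirichlet_family (a b : fseries) (z : L)
    (p : {p : L * L | p.1 * p.2 == z}) : C := a (val p).1 * b (val p).2.

Definition dirichlet_prod (a b : fseries) : fseries := fun z =>
  csum (dirichlet_family a b (z := z)).

Definition dirichlet_defined (a b : fseries) : Prop :=
  abs_summable (dirichlet_family a b (z := 0)) /\ Hilb (dirichlet_prod a b).

Definition zero_sum : set fseries := [set a | abs_summable a /\ csum a = 0].

Definition line (a : fseries) : set fseries :=
  [set b | exists2 c : C, c != 0 & b = (fun x => c * a x)].

(* Points are classes modulo C^*, as sets of series. *)
Definition PHilb : set (set fseries) :=
  line @` [set a | Hilb a /\ a <> (fun=> 0)].

Definition Nonlin : set (set fseries) := line @` (Hilb `\` zero_sum).

Definition fs_repr (p : PHilb) : fseries := xget (fun=> 0) (val p).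

(* Does not depend on the representatives. *)
Definition fs_dist (p q : PHilb) : R :=
  acos (normc (inner (fs_repr p) (fs_repr q))
        / (hnorm (fs_repr p) * hnorm (fs_repr q))).

(* x (+) y = z, resp. x (x) y = z, as partial operations on Nonlin: the
   operation is defined at (x, y) iff such a z (in Nonlin) exists. *)
Definition is_cauchy (x y z : Nonlin) : Prop :=
  exists a b, [/\ val x a, val y b, cauchy_defined a b
                & val z (cauchy_prod a b)].

Definition is_dirichlet (x y z : Nonlin) : Prop :=
  exists a b, [/\ val x a, val y b, dirichlet_defined a b
                & val z (dirichlet_prod a b)].

Definition embedding := {rmorphism L -> C}.

(* M contains exactly one member of each pair {mu, conj mu}; in the totally
   real case this forces M to contain all embeddings. *)
Definition embedding_choice (M : set embedding) : Prop :=
  forall mu : embedding, exists! nu : embedding,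
    M nu /\ (nu =1 mu \/ nu =1 (fun x => conjc (mu x))).

Definition totally_real : Prop :=
  forall (mu : embedding) (x : L), complex.Im (mu x) = 0.

(* The pair of signs of real and imaginary parts tells the four open half-axes
   and the four open quadrants apart; positive and negative reals are (1, 0)
   and (-1, 0). *)
Definition piece (z : C) : int * int :=
  (sgz (complex.Re z), sgz (complex.Im z)).

Variable M : set embedding.

Definition sign (x : L) : M -> int * int :=
  fun mu => piece ((val mu : embedding) x).

(* All vectors of +/- in the totally real case, realized ones otherwise. *)
Definition Mho : set (M -> int * int) :=
  [set t | (totally_real /\ forall mu, t mu = (1, 0) \/ t mu = (-1, 0))
        \/ (~ totally_real /\ exists2 x : L, x != 0 & t = sign x)].

Definition Hilb_sign (t : M -> int * int) : set fseries :=
  [set a | Hilb a /\ forall x, a x != 0 -> x != 0 /\ sign x = t].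

Definition PHilb_sign (t : M -> int * int) : set PHilb :=
  [set p | exists2 a, Hilb_sign t a & val p = line a].

Definition graded (T : PHilb -> PHilb) : Prop :=
  exists2 iota : Mho -> Mho, bijective iota &
    forall t : Mho, T @` PHilb_sign (val t) = PHilb_sign (val (iota t)).

Definition fs_isometry (T : PHilb -> PHilb) : Prop :=
  forall p q, fs_dist (T p) (T q) = fs_dist p q.

(* Whenever [F] (+) [G] is defined, so is U [F] (+) U [G], and U preserves it;
   likewise for (x).  That U is invertible on Nonlin is not assumed. *)
Definition nonlinear_automorphism (U : Nonlin -> Nonlin) : Prop :=
  [/\ exists T : PHilb -> PHilb,
        [/\ bijective T, fs_isometry T, graded T
          & forall (p : PHilb) (x : Nonlin), val p = val x ->
              val (T p) = val (U x)],
      forall x y z, is_cauchy x y z -> is_cauchy (U x) (U y) (U z)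
    & forall x y z, is_dirichlet x y z -> is_dirichlet (U x) (U y) (U z)].

(* The nonlinear field of the subfield j(K), inside that of L. *)
Definition Nonlin_sub (K : fieldType) (j : {rmorphism K -> L}) : set Nonlin :=
  [set x | exists2 a, val x a & forall y, a y != 0 -> range j y].

Definition nonlinear_galois_group (K : fieldType) (j : {rmorphism K -> L}) :
    set (Nonlin -> Nonlin) :=
  [set U | nonlinear_automorphism U /\ forall x, Nonlin_sub j x -> U x = x].

End NonlinearField.

(* Main.v *)
From HB Require Import structures.
Require Import Defs.
From mathcomp Require Import all_boot all_order all_algebra all_field.
From mathcomp Require Import complex.
From mathcomp Require Import all_classical all_reals all_analysis.
From mathcomp Require Import ring lra.

Set Implicit Arguments.
Unset Strict Implicit.
Unset Printing Implicit Defensive.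

Import Order.TTheory GRing.Theory Num.Theory.
Import Normc.

Local Open Scope classical_set_scope.
Local Open Scope ring_scope.

(** A field automorphism [s] of [L] over [K] acts on series by moving the
coefficient at [x] to [s x].  This respects norms, both products and the
grading: composing with [s] permutes the chosen embeddings up to complex
conjugation, so the sign of [s x] is a function of the sign of [x].  The
substance of the theorem is that every nonlinear automorphism [U] fixing the
series supported on [K] arises in this way from a unique [s].

[U] maps monomials to monomials.  Let [f] represent the image of rho^x.  Since
rho^0 is fixed and rho^0 (x) rho^x = rho^0, the Dirichlet product of rho^0 and
[f] is defined, which forces [f] to be absolutely summable.  Since the rho^n
are fixed, the relations rho^n (x) rho^x = rho^(n x) and
rho^x (+) rho^(n x) = rho^((n + 1) x) say that, up to constants, the additive
convolution of [f] with its dilate by [n] is its dilate by [n + 1].  By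
[dilation_stable_support], such an [f] has a one-point support.  Indeed, for
u <> v the product f(u) f(v) contributes to the coefficient of the convolution
at u + n v; for large [n] all other contributions involve the tail of [f], and
so does the value prescribed for the coefficient, a bounded multiple of [f] at
(u + n v) / (n + 1).  Hence f(u) f(v) is arbitrarily small, thus zero.

So [U] maps rho^x to rho^(s x), and compatibility with the products on monomials
makes [s] a field endomorphism fixing [K]; it is bijective because [L] is
algebraic over [K] ([exists_rmorphism], [algebraic_endo_bij]).

Finally [U] is determined by [s].  The series rho^0 + c rho^1 is supported on
[K], hence fixed, and Dirichlet and Cauchy products by monomials carry it to any
rho^x + c rho^y; so [U] maps rho^x + c rho^y to rho^(s x) + c rho^(s y)
([image_of_two_term]).  As [U] is an isometry, the moduli of the inner products
of a series with rho^x, rho^x + rho^y and rho^x + i rho^y are preserved; they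
determine the products of one coefficient by the conjugate of another, hence
the class of the series ([image_of_series]).  The antiunitary map conjugating
all coefficients respects the grading and both products; it is excluded only
because rho^0 + i rho^1 is fixed. *)

(** * Sums of nonnegative real families *)

Section NonnegativeSums.
Variable R : realType.

(** The nonnegative family [u] is summable. *)
Definition has_tsum (I : choiceType) (u : I -> R) : Prop :=
  (\esum_(i in [set: I]) (u i)%:E < +oo)%E.

(** The sum of a summable nonnegative family, as a real number; it is 0 when the
family is not summable. *)
Definition tsum (I : choiceType) (u : I -> R) : R :=
  fine (\esum_(i in [set: I]) (u i)%:E).

Section OneIndexType.
Variable I : choiceType.
Implicit Types u v : I -> R.

Lemma tsumK u : (forall i, 0 <= u i) -> has_tsum u ->
  (\esum_(i in [set: I]) (u i)%:E = (tsum u)%:E)%E.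
Proof.
move=> u0 fu; rewrite /tsum fineK// ge0_fin_numE//.
by apply: esum_ge0 => i _; rewrite lee_fin.
Qed.

Lemma tsum_ge0 u : (forall i, 0 <= u i) -> 0 <= tsum u.
Proof. by move=> u0; apply/fine_ge0/esum_ge0 => i _; rewrite lee_fin. Qed.

Lemma has_tsum_le u v : (forall i, u i <= v i) -> has_tsum v -> has_tsum u.
Proof. by move=> uv; apply: le_lt_trans; apply: le_esum => i _; rewrite lee_fin. Qed.

Lemma le_tsum u v : (forall i, 0 <= u i) -> (forall i, u i <= v i) ->
  has_tsum v -> tsum u <= tsum v.
Proof.
move=> u0 uv fv; have fu := has_tsum_le uv fv.
have v0 i : 0 <= v i by apply: le_trans (uv i).
rewrite -lee_fin -!tsumK//; apply: le_esum => i _; by rewrite lee_fin.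
Qed.

Lemma has_tsumD u v : (forall i, 0 <= u i) -> (forall i, 0 <= v i) ->
  has_tsum u -> has_tsum v -> has_tsum (fun i => u i + v i).
Proof.
move=> u0 v0 fu fv; rewrite /has_tsum; under eq_esum do rewrite EFinD.
by rewrite esumD; [exact: lte_add_pinfty|move=> i _; rewrite lee_fin..].
Qed.

Lemma tsumD u v : (forall i, 0 <= u i) -> (forall i, 0 <= v i) ->
  has_tsum u -> has_tsum v -> tsum (fun i => u i + v i) = tsum u + tsum v.
Proof.
move=> u0 v0 fu fv; rewrite {1}/tsum; under eq_esum do rewrite EFinD.
rewrite esumD; [|by move=> i _; rewrite lee_fin..].
by rewrite !tsumK.
Qed.

Lemma tsumZ_le (c : R) u : 0 <= c -> (forall i, 0 <= u i) -> has_tsum u ->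
  (\esum_(i in [set: I]) (c * u i)%:E <= (c * tsum u)%:E)%E.
Proof.
move=> c0 u0 fu; apply: ge_ereal_sup => _ [X [finX _]] <-.
under eq_fsbigr do rewrite EFinM.
rewrite -ge0_mule_fsumr; last by move=> i; rewrite lee_fin.
rewrite EFinM lee_pmul//; first by apply: fsume_ge0 => i _; rewrite lee_fin.
by rewrite -tsumK//; apply: ereal_sup_ubound; exists X.
Qed.

Lemma has_tsumZ (c : R) u : 0 <= c -> (forall i, 0 <= u i) -> has_tsum u ->
  has_tsum (fun i => c * u i).
Proof. by move=> c0 u0 fu; apply: le_lt_trans (tsumZ_le c0 u0 fu) _; rewrite ltry. Qed.

Lemma tsumZ (c : R) u : 0 <= c -> (forall i, 0 <= u i) -> has_tsum u ->
  tsum (fun i => c * u i) = c * tsum u.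
Proof.
move=> c0 u0 fu; have cu0 i : 0 <= c * u i by rewrite mulr_ge0.
have fcu := has_tsumZ c0 u0 fu.
apply/eqP; rewrite eq_le -lee_fin -tsumK// tsumZ_le//=.
have [->|cn0] := eqVneq c 0; first by rewrite mul0r tsum_ge0// => i; rewrite mul0r.
have cp : 0 < c by rewrite lt_neqAle eq_sym cn0.
rewrite -ler_pdivlMl// -lee_fin -tsumK//.
rewrite (eq_esum (b := fun i => (c^-1 * (c * u i))%:E)).
  by apply: tsumZ_le => //; rewrite invr_ge0.
by move=> i _; rewrite mulKf.
Qed.

Lemma esum_support1 u i0 : 0 <= u i0 -> (forall i, i != i0 -> u i = 0) ->
  (\esum_(i in [set: I]) (u i)%:E = (u i0)%:E)%E.
Proof.
move=> u0 ui; rewrite (esumID [set i0]); last first.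
  by move=> i _; rewrite lee_fin; have [->//|/ui ->] := eqVneq i i0.
rewrite !setTI esum_set1 ?lee_fin// esum1 ?adde0// => i /= /eqP ii0.
by rewrite ui.
Qed.

Lemma has_tsum_support1 u i0 : 0 <= u i0 -> (forall i, i != i0 -> u i = 0) ->
  has_tsum u.
Proof. by move=> ? ?; rewrite /has_tsum (esum_support1 (i0 := i0))// ltry. Qed.

Lemma tsum_support1 u i0 : 0 <= u i0 -> (forall i, i != i0 -> u i = 0) ->
  tsum u = u i0.
Proof. by move=> ? ?; rewrite /tsum (esum_support1 (i0 := i0)). Qed.

Lemma tsum_ge_term u i0 : (forall i, 0 <= u i) -> has_tsum u -> u i0 <= tsum u.
Proof.
move=> u0 fu; pose v i := if i == i0 then u i else 0.
have <- : tsum v = u i0.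
  rewrite (tsum_support1 (i0 := i0)) /v ?eqxx//.
  by move=> i /negbTE ->.
by apply: le_tsum => // i; rewrite /v; case: ifP.
Qed.

(** All but finitely many terms of a summable family have an arbitrarily small
sum. *)
Lemma tsum_tail u (e : R) : (forall i, 0 <= u i) -> has_tsum u -> 0 < e ->
  exists2 A : seq I, has_tsum (fun i => if i \in A then 0 else u i)
    & tsum (fun i => if i \in A then 0 else u i) <= e.
Proof.
move=> u0 fu e0.
have fn : (ereal_sup [set \sum_(x \in A) (u x)%:E | A in fsets [set: I]] \is a fin_num)%E.
  rewrite ge0_fin_numE//; apply: (@esum_ge0 R I setT (EFin \o u)) => i _.
  by rewrite lee_fin.
have [_ [X [finX _] <-] Xe] := ub_ereal_sup_adherent e0 fn.
have [s Es] := (finite_seqP X).1 finX.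
have v0 i : 0 <= if i \in s then 0 else u i by case: ifP.
have w0 i : 0 <= if i \in s then u i else 0 by case: ifP.
have fv : has_tsum (fun i => if i \in s then 0 else u i).
  by apply: has_tsum_le fu => i; case: ifP.
have fw : has_tsum (fun i => if i \in s then u i else 0).
  by apply: has_tsum_le fu => i; case: ifP.
exists s => //.
have sE : tsum u = tsum (fun i => if i \in s then u i else 0)
    + tsum (fun i => if i \in s then 0 else u i).
  rewrite -tsumD//; congr (fine _); apply: eq_esum => i _.
  by case: ifP; rewrite ?addr0 ?add0r.
have wX : (\sum_(x \in X) (u x)%:E <= (tsum (fun i => if i \in s then u i else 0))%:E)%E.
  rewrite -tsumK//; apply: esum_ge; exists X => //.
  by apply: lee_fsum => // i; rewrite Es /= => ->.
have := lt_le_trans Xe wX.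
rewrite -[X in (X - _)%E]/(\esum_(i in [set: I]) (u i)%:E)%E tsumK// -EFinB lte_fin.
by rewrite sE; lra.
Qed.

End OneIndexType.

Lemma reindex_esumT (I J : choiceType) (e : I -> J) (u : J -> R) : bijective e ->
  (\esum_(i in [set: I]) (u (e i))%:E = \esum_(j in [set: J]) (u j)%:E)%E.
Proof.
move=> be; apply/esym; apply: (@reindex_esum R I J setT setT e (fun j => (u j)%:E)).
by rewrite setTT_bijective.
Qed.

Lemma tsum_reindex (I J : choiceType) (e : I -> J) (u : J -> R) : bijective e ->
  tsum (fun i => u (e i)) = tsum u.
Proof. by move=> be; rewrite /tsum reindex_esumT. Qed.

Lemma has_tsum_reindex (I J : choiceType) (e : I -> J) (u : J -> R) : bijective e ->
  has_tsum u -> has_tsum (fun i => u (e i)).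
Proof. by move=> be; rewrite /has_tsum reindex_esumT. Qed.

Lemma has_tsum_inj (I J : choiceType) (e : I -> J) (u : J -> R) : injective e ->
  (forall j, 0 <= u j) ->
  has_tsum u -> has_tsum (fun i => u (e i)).
Proof.
move=> ie u0; apply: le_lt_trans.
rewrite -(esum_image setT e (fun j => (u j)%:E)); last by move=> x y _ _; exact: ie.
rewrite esum_mkcond; apply: le_esum => j _.
by case: ifP => //; rewrite lee_fin.
Qed.

End NonnegativeSums.

(** * Sums of real and complex families *)

Section SignedSums.
Variable R : realType.

Section OneIndexType.
Variable I : choiceType.
Implicit Types f g : I -> R.

Lemma has_tsum_pos f : has_tsum (fun i => `|f i|) -> has_tsum f^\+.
Proof.
apply: has_tsum_le => i; rewrite /funrpos.
by rewrite ge_max ler_norm normr_ge0.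
Qed.

Lemma has_tsum_neg f : has_tsum (fun i => `|f i|) -> has_tsum f^\-.
Proof.
apply: has_tsum_le => i; rewrite /funrneg.
by rewrite ge_max -normrN ler_norm normr_ge0.
Qed.

(** The sum may be computed from any difference of two summable nonnegative
families; additivity and homogeneity of [rsum] follow. *)
Lemma rsum_sub f (u v : I -> R) : (forall i, 0 <= u i) -> (forall i, 0 <= v i) ->
  has_tsum u -> has_tsum v -> (forall i, f i = u i - v i) ->
  rsum f = tsum u - tsum v.
Proof.
move=> u0 v0 fu fv fE.
have pos0 i : 0 <= f^\+ i by apply: funrpos_ge0.
have neg0 i : 0 <= f^\- i by apply: funrneg_ge0.
have ff : has_tsum (fun i => `|f i|).
  apply: has_tsum_le (has_tsumD u0 v0 fu fv) => i.
  by rewrite fE (le_trans (ler_normB _ _))// !ger0_norm.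
have fp := has_tsum_pos ff; have fn := has_tsum_neg ff.
have : tsum f^\+ + tsum v = tsum f^\- + tsum u.
  rewrite -!tsumD//; congr (fine _); apply: eq_esum => i _; congr (_%:E).
  rewrite /funrpos /funrneg fE; have [] := leP (u i - v i) 0 => ?.
    by rewrite max_l ?oppr_ge0//; lra.
  by rewrite max_r ?oppr_le0 ?ltW//; lra.
by rewrite /rsum -/(tsum _) -/(tsum _); lra.
Qed.

Lemma rsumE f : has_tsum (fun i => `|f i|) ->
  exists u v : I -> R, [/\ [/\ forall i, 0 <= u i, forall i, 0 <= v i,
   has_tsum u & has_tsum v], forall i, f i = u i - v i & rsum f = tsum u - tsum v].
Proof.
move=> ff; exists f^\+, f^\-; split=> //.
- split.
  + by move=> i; rewrite /funrpos le_max lexx orbT.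
  + by move=> i; rewrite /funrneg le_max lexx orbT.
  + exact: has_tsum_pos.
  + exact: has_tsum_neg.
- move=> i; rewrite /funrpos /funrneg; have [] := leP (f i) 0 => ?.
    by rewrite max_l ?oppr_ge0//; lra.
  by rewrite max_r ?oppr_le0 ?ltW//; lra.
Qed.

Lemma eq_rsum f g : f =1 g -> rsum f = rsum g.
Proof. by move=> /funext ->. Qed.

Lemma rsumD f g : has_tsum (fun i => `|f i|) -> has_tsum (fun i => `|g i|) ->
  rsum (fun i => f i + g i) = rsum f + rsum g.
Proof.
move=> /rsumE[u [v [[u0 v0 fu fv] fE ->]]] /rsumE[u' [v' [[u0' v0' fu' fv'] gE ->]]].
rewrite (rsum_sub (u := fun i => u i + u' i) (v := fun i => v i + v' i)).
- by rewrite !tsumD//; ring.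
- by move=> i; rewrite addr_ge0.
- by move=> i; rewrite addr_ge0.
- exact: has_tsumD.
- exact: has_tsumD.
- by move=> i; rewrite fE gE; ring.
Qed.

Lemma rsumN f : has_tsum (fun i => `|f i|) -> rsum (fun i => - f i) = - rsum f.
Proof.
move=> /rsumE[u [v [[u0 v0 fu fv] fE ->]]].
by rewrite (rsum_sub (u := v) (v := u))// => [|i]; rewrite ?fE opprB.
Qed.

Lemma rsumZ (c : R) f : has_tsum (fun i => `|f i|) -> rsum (fun i => c * f i) = c * rsum f.
Proof.
wlog c0 : c / 0 <= c => [hw ff|].
  have [/hw ->//|c0] := leP 0 c.
  rewrite -[RHS]opprK -mulNr -hw ?oppr_ge0 ?ltW// -rsumN.
    by apply: eq_rsum => i; rewrite mulNr opprK.
  apply: has_tsum_le (has_tsumZ (c := - c) _ _ ff) => //.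
  - by move=> i; rewrite normrM ger0_norm// oppr_ge0 ltW.
  - by rewrite oppr_ge0 ltW.
move=> /rsumE[u [v [[u0 v0 fu fv] fE ->]]].
rewrite (rsum_sub (u := fun i => c * u i) (v := fun i => c * v i)).
- by rewrite !tsumZ//; ring.
- by move=> i; rewrite mulr_ge0.
- by move=> i; rewrite mulr_ge0.
- exact: has_tsumZ.
- exact: has_tsumZ.
- by move=> i; rewrite fE mulrBr.
Qed.

Lemma rsum_support1 f i0 : (forall i, i != i0 -> f i = 0) -> rsum f = f i0.
Proof.
move=> f0; rewrite /rsum -/(tsum _) -/(tsum _).
rewrite !(tsum_support1 (i0 := i0)).
- rewrite /funrpos /funrneg; have [] := leP (f i0) 0 => ?.
    by rewrite max_l ?oppr_ge0//; lra.
  by rewrite max_r ?oppr_le0 ?ltW//; lra.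
- by apply: funrneg_ge0.
- by move=> i /f0; rewrite /funrneg => ->; rewrite oppr0 maxxx.
- by apply: funrpos_ge0.
- by move=> i /f0; rewrite /funrpos => ->; rewrite maxxx.
Qed.

Lemma rsum0 f : (forall i, f i = 0) -> rsum f = 0.
Proof.
by move=> f0; rewrite (rsum_sub (u := fun=> 0) (v := fun=> 0)) ?subrr//;
  do ?[by rewrite /has_tsum esum1]; move=> i; rewrite f0 subrr.
Qed.

Lemma rsum_le f (u : I -> R) : (forall i, f i <= u i) -> has_tsum (fun i => `|f i|) ->
  has_tsum u -> (forall i, 0 <= u i) -> rsum f <= tsum u.
Proof.
move=> fu ff hu u0; rewrite /rsum -/(tsum _) -/(tsum _).
rewrite lerBlDr (@le_trans _ _ (tsum u))//.
  apply: le_tsum => // i; by rewrite /funrpos ge_max fu u0.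
rewrite lerDl; apply: tsum_ge0 => i; by apply: funrneg_ge0.
Qed.

End OneIndexType.

Lemma rsum_reindex (I J : choiceType) (e : I -> J) (f : J -> R) : bijective e ->
  rsum (fun i => f (e i)) = rsum f.
Proof.
by move=> be; rewrite /rsum -!/(tsum _) (tsum_reindex f^\+ be) (tsum_reindex f^\- be).
Qed.

End SignedSums.

Section ComplexModulus.
Variable R : realType.
Implicit Types z w : R[i].

Lemma normc_ge0 z : 0 <= normc z.
Proof. by case: z => a b; rewrite sqrtr_ge0. Qed.

Lemma normc_sqr z : normc z ^+ 2 = complex.Re z ^+ 2 + complex.Im z ^+ 2.
Proof. by case: z => a b; rewrite /= sqr_sqrtr// addr_ge0// sqr_ge0. Qed.

Lemma normc_eq0 z : (normc z == 0) = (z == 0).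
Proof. by apply/eqP/eqP => [/eq0_normc//|->]; rewrite normc0. Qed.

Lemma normc_gt0 z : (0 < normc z) = (z != 0).
Proof. by rewrite lt_neqAle normc_ge0 andbT eq_sym normc_eq0. Qed.

Lemma normc_conjc z : normc (conjc z) = normc z.
Proof. by case: z => a b /=; rewrite sqrrN. Qed.

Lemma normRe_le z : `|complex.Re z| <= normc z.
Proof.
by rewrite -(ler_pXn2r (n := 2))// ?nnegrE ?normc_ge0// real_normK ?num_real//
  normc_sqr lerDl sqr_ge0.
Qed.

Lemma normIm_le z : `|complex.Im z| <= normc z.
Proof.
by rewrite -(ler_pXn2r (n := 2))// ?nnegrE ?normc_ge0// real_normK ?num_real//
  normc_sqr lerDr sqr_ge0.
Qed.

Lemma normcD_le z w : normc (z + w) <= normc z + normc w.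
Proof. exact: le_normcD. Qed.

Lemma ReM z w : complex.Re (z * w) =
  complex.Re z * complex.Re w - complex.Im z * complex.Im w.
Proof. by case: z; case: w. Qed.

Lemma ImM z w : complex.Im (z * w) =
  complex.Re z * complex.Im w + complex.Im z * complex.Re w.
Proof. by case: z; case: w. Qed.

Lemma ReD z w : complex.Re (z + w) = complex.Re z + complex.Re w.
Proof. by case: z; case: w. Qed.

Lemma ImD z w : complex.Im (z + w) = complex.Im z + complex.Im w.
Proof. by case: z; case: w. Qed.

Lemma complex_ext z w : complex.Re z = complex.Re w -> complex.Im z = complex.Im w -> z = w.
Proof. by case: z => a b; case: w => c d /= -> ->. Qed.

End ComplexModulus.

Section ComplexSums.
Variable R : realType.

Section OneIndexType.
Variable I : choiceType.
Implicit Types f g : I -> R[i].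

Lemma abs_summableE f : abs_summable f = has_tsum (fun i => normc (f i)).
Proof.
rewrite /abs_summable /summable /has_tsum; congr (_ < _)%E.
by apply: eq_esum => i _; rewrite gee0_abs// lee_fin normc_ge0.
Qed.

Lemma abs_summable_Re f : abs_summable f -> has_tsum (fun i => `|complex.Re (f i)|).
Proof. by rewrite abs_summableE; apply: has_tsum_le => i; exact: normRe_le. Qed.

Lemma abs_summable_Im f : abs_summable f -> has_tsum (fun i => `|complex.Im (f i)|).
Proof. by rewrite abs_summableE; apply: has_tsum_le => i; exact: normIm_le. Qed.

Lemma abs_summable_le f (u : I -> R) : (forall i, normc (f i) <= u i) -> has_tsum u ->
  abs_summable f.
Proof. by rewrite abs_summableE; exact: has_tsum_le. Qed.

Lemma eq_csum f g : f =1 g -> csum f = csum g.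
Proof. by move=> /funext ->. Qed.

Lemma abs_summableD f g : abs_summable f -> abs_summable g ->
  abs_summable (fun i => f i + g i).
Proof.
rewrite !abs_summableE => sf sg.
by apply: has_tsum_le (has_tsumD _ _ sf sg) => i; rewrite ?normc_ge0 ?normcD_le.
Qed.

Lemma abs_summableZ (c : R[i]) f : abs_summable f -> abs_summable (fun i => c * f i).
Proof.
rewrite !abs_summableE => sf.
apply: has_tsum_le (has_tsumZ (c := normc c) _ _ sf) => [i||i]; rewrite ?normc_ge0//.
by rewrite normcM.
Qed.

Lemma csumD f g : abs_summable f -> abs_summable g ->
  csum (fun i => f i + g i) = csum f + csum g.
Proof.
move=> sf sg; apply: complex_ext; rewrite ?ReD ?ImD /=.
  rewrite -rsumD; [|exact: abs_summable_Re..].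
  by apply: eq_rsum => i; rewrite ReD.
rewrite -rsumD; [|exact: abs_summable_Im..].
by apply: eq_rsum => i; rewrite ImD.
Qed.

Lemma csumZ (c : R[i]) f : abs_summable f -> csum (fun i => c * f i) = c * csum f.
Proof.
move=> sf; have sr := abs_summable_Re sf; have si := abs_summable_Im sf.
have sZ (t : R) (u : I -> R) : has_tsum (fun i => `|u i|) -> has_tsum (fun i => `|t * u i|).
  move=> su; apply: has_tsum_le (has_tsumZ (c := `|t|) _ _ su) => // i.
  by rewrite normrM.
apply: complex_ext; rewrite ?ReM ?ImM /=.
  rewrite -mulNr -!rsumZ// -rsumD; [|exact: sZ..].
  by apply: eq_rsum => i; rewrite ReM mulNr.
rewrite -!rsumZ// -rsumD; [|exact: sZ..].
by apply: eq_rsum => i; rewrite ImM.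
Qed.

Lemma csum_support1 f i0 : (forall i, i != i0 -> f i = 0) -> csum f = f i0.
Proof.
move=> f0; rewrite /csum (rsum_support1 (i0 := i0)); last by move=> i /f0 ->.
by rewrite (rsum_support1 (i0 := i0)); [case: (f i0)|move=> i /f0 ->].
Qed.

Lemma csum0 f : (forall i, f i = 0) -> csum f = 0.
Proof. by move=> f0; rewrite /csum !rsum0// => i; rewrite f0. Qed.

Lemma abs_summable_support1 f i0 : (forall i, i != i0 -> f i = 0) -> abs_summable f.
Proof.
move=> f0; rewrite abs_summableE; apply: (has_tsum_support1 (i0 := i0)).
  exact: normc_ge0.
by move=> i /f0 ->; rewrite normc0.
Qed.

Lemma normc_csum_le f : abs_summable f -> normc (csum f) <= tsum (fun i => normc (f i)).
Proof.
move=> sf; have [->|s0] := eqVneq (csum f) 0.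
  by rewrite normc0 tsum_ge0// => i; exact: normc_ge0.
(* with s the sum, the numbers Re (conj s * f i) add up to |s|^2 *)
have sp : 0 < normc (csum f) by rewrite normc_gt0.
have sf' : has_tsum (fun i => normc (f i)) by rewrite -abs_summableE.
have Es : normc (csum f) ^+ 2 = rsum (fun i => complex.Re (conjc (csum f) * f i)).
  transitivity (complex.Re (csum (fun i => conjc (csum f) * f i))); last by [].
  by rewrite csumZ// normc_sqr; case: (csum f) => a b /=; ring.
have := @rsum_le R I (fun i => complex.Re (conjc (csum f) * f i))
  (fun i => normc (csum f) * normc (f i)).
rewrite -Es tsumZ ?normc_ge0//; last by move=> i; exact: normc_ge0.
rewrite expr2 ler_pM2l//; apply.
- move=> i; rewrite -(normc_conjc (csum f)) -normcM.
  exact: le_trans (ler_norm _) (normRe_le _).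
- exact/abs_summable_Re/abs_summableZ.
- by apply: has_tsumZ => // [|i]; exact: normc_ge0.
- by move=> i; rewrite mulr_ge0// normc_ge0.
Qed.

End OneIndexType.

Lemma csum_reindex (I J : choiceType) (e : I -> J) (f : J -> R[i]) : bijective e ->
  csum (fun i => f (e i)) = csum f.
Proof.
move=> be; rewrite /csum.
by rewrite (rsum_reindex (fun j => complex.Re (f j)) be)
  (rsum_reindex (fun j => complex.Im (f j)) be).
Qed.

Lemma abs_summable_inj (I J : choiceType) (e : I -> J) (f : J -> R[i]) : injective e ->
  abs_summable f -> abs_summable (fun i => f (e i)).
Proof.
move=> ie; rewrite !abs_summableE.
by apply: has_tsum_inj => // j; exact: normc_ge0.
Qed.

End ComplexSums.

(** * The Hilbert space of series *)

Section HilbertSpace.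
Variables (R : realType) (L : fieldType).
Implicit Types a b : fseries R L.

Lemma HilbE a : Hilb a = has_tsum (fun x => normc (a x) ^+ 2).
Proof.
rewrite /Hilb /= /summable /has_tsum; congr (_ < _)%E.
by apply: eq_esum => i _; rewrite gee0_abs// lee_fin sqr_ge0.
Qed.

Lemma HilbZ (c : R[i]) a : Hilb a -> Hilb (fun x => c * a x).
Proof.
rewrite !HilbE => ha.
apply: has_tsum_le (has_tsumZ (c := normc c ^+ 2) _ _ ha) => [x||x]; rewrite ?sqr_ge0//.
by rewrite normcM exprMn.
Qed.

Lemma Hilb_abs_summable a : abs_summable a -> Hilb a.
Proof.
rewrite abs_summableE HilbE => sa.
have h0 : 0 <= tsum (fun x => normc (a x)) by apply: tsum_ge0 => x; exact: normc_ge0.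
apply: has_tsum_le (has_tsumZ h0 _ sa) => x; rewrite ?normc_ge0//.
rewrite expr2 ler_wpM2r ?normc_ge0//.
by apply: (tsum_ge_term x) => // y; exact: normc_ge0.
Qed.

(** [I] indexes a family of pairs of exponents in which each exponent occurs at
most once on either side, such as the pairs of sum [z]. *)
Lemma Hilb_mul_summable (I : choiceType) (e1 e2 : I -> L) a b :
  injective e1 -> injective e2 -> Hilb a -> Hilb b ->
  abs_summable (fun i => a (e1 i) * b (e2 i)).
Proof.
rewrite !HilbE => i1 i2 ha hb.
have ha' := has_tsum_inj i1 (fun=> sqr_ge0 _) ha.
have hb' := has_tsum_inj i2 (fun=> sqr_ge0 _) hb.
apply: abs_summable_le (has_tsumD (fun=> sqr_ge0 _) (fun=> sqr_ge0 _) ha' hb') => i.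
rewrite normcM; have := normc_ge0 (a (e1 i)); have := normc_ge0 (b (e2 i)).
have := sqr_ge0 (normc (a (e1 i)) - normc (b (e2 i))).
nra.
Qed.

Lemma Hilb_reindex (s : L -> L) a : bijective s -> Hilb a -> Hilb (a \o s).
Proof.
rewrite !HilbE => bs; exact: (has_tsum_reindex (u := fun x => normc (a x) ^+ 2) bs).
Qed.

Lemma hnormE a : hnorm a = Num.sqrt (tsum (fun x => normc (a x) ^+ 2)).
Proof. by []. Qed.

Lemma hnorm_sqr a : hnorm a ^+ 2 = tsum (fun x => normc (a x) ^+ 2).
Proof. by rewrite hnormE sqr_sqrtr// tsum_ge0// => x; exact: sqr_ge0. Qed.

Lemma fseries_neq0 a : a <> (fun=> 0) -> exists x, a x != 0.
Proof.
move=> a0; apply: contrapT => h; apply: a0; apply/funext => x.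
by apply/eqP; apply: contrapT => /negP ax; apply: h; exists x.
Qed.

Lemma hnorm_gt0 a : Hilb a -> a <> (fun=> 0) -> 0 < hnorm a.
Proof.
rewrite HilbE => ha /fseries_neq0[x ax].
rewrite hnormE sqrtr_gt0.
apply: lt_le_trans (tsum_ge_term x (fun=> sqr_ge0 _) ha).
by rewrite exprn_gt0// normc_gt0.
Qed.

Lemma hnormZ (c : R[i]) a : Hilb a -> hnorm (fun x => c * a x) = normc c * hnorm a.
Proof.
rewrite HilbE => ha; rewrite !hnormE.
under eq_fun do rewrite normcM exprMn.
rewrite tsumZ ?sqr_ge0//; last by move=> i; exact: sqr_ge0.
by rewrite sqrtrM ?sqr_ge0// sqrtr_sqr ger0_norm// normc_ge0.
Qed.

Lemma hnorm_reindex (s : L -> L) a : bijective s -> hnorm (a \o s) = hnorm a.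
Proof.
by move=> bs; rewrite !hnormE (tsum_reindex (fun x => normc (a x) ^+ 2) bs).
Qed.

Lemma inner_summable a b : Hilb a -> Hilb b -> abs_summable (fun x => a x * conjc (b x)).
Proof.
move=> ha hb; have hb' : Hilb (fun x => conjc (b x)).
  by move: hb; rewrite !HilbE; under eq_fun do rewrite -normc_conjc.
exact: (@Hilb_mul_summable L id id a (fun x => conjc (b x))).
Qed.

Lemma innerZZ (c d : R[i]) a b : Hilb a -> Hilb b ->
  inner (fun x => c * a x) (fun x => d * b x) = c * conjc d * inner a b.
Proof.
move=> ha hb; rewrite /inner -csumZ; last exact: inner_summable.
by apply: eq_csum => x; rewrite rmorphM; ring.
Qed.

Lemma inner_reindex (s : L -> L) a b : bijective s -> inner (a \o s) (b \o s) = inner a b.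
Proof. by move=> bs; rewrite /inner (csum_reindex (fun x => a x * conjc (b x)) bs). Qed.

Lemma cauchy_schwarz a b : Hilb a -> Hilb b -> a <> (fun=> 0) -> b <> (fun=> 0) ->
  normc (inner a b) <= hnorm a * hnorm b.
Proof.
move=> ha hb a0 b0; have sab := inner_summable ha hb.
have A0 := hnorm_gt0 ha a0; have B0 := hnorm_gt0 hb b0.
apply: le_trans (normc_csum_le sab) _.
have := hnorm_sqr a; have := hnorm_sqr b.
move: (hnorm a) (hnorm b) A0 B0 => A B A0 B0 EB EA.
rewrite HilbE in ha; rewrite HilbE in hb.
(* weighted inequality u v <= s u^2 + t v^2, with equality when u / v = A / B *)
pose s := B / A / 2; pose t := A / B / 2.
have s0 : 0 < s by rewrite /s !divr_gt0.
have t0 : 0 < t by rewrite /t !divr_gt0.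
have hs := has_tsumZ (ltW s0) (fun=> sqr_ge0 _) ha.
have ht := has_tsumZ (ltW t0) (fun=> sqr_ge0 _) hb.
have -> : A * B = s * A ^+ 2 + t * B ^+ 2.
  by rewrite /s /t; field; rewrite !lt0r_neq0.
have ps i : 0 <= s * normc (a i) ^+ 2 by rewrite mulr_ge0 ?sqr_ge0// ltW.
have pt i : 0 <= t * normc (b i) ^+ 2 by rewrite mulr_ge0 ?sqr_ge0// ltW.
rewrite EA EB -(tsumZ (ltW s0) (fun=> sqr_ge0 _) ha).
rewrite -(tsumZ (ltW t0) (fun=> sqr_ge0 _) hb).
rewrite -tsumD//; apply: le_tsum => [i|i|]; [exact: normc_ge0| |exact: has_tsumD].
rewrite normcM normc_conjc; move: (normc (a i)) (normc (b i)) => u v.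
have -> : s * u ^+ 2 + t * v ^+ 2 = u * v + A / B / 2 * (B / A * u - v) ^+ 2.
  by rewrite /s /t; field; rewrite !lt0r_neq0.
by rewrite lerDl mulr_ge0 ?sqr_ge0// ltW.
Qed.

End HilbertSpace.

(** * Series whose dilates are their convolution powers *)

Section Eventually.

Lemma eventually_of_inj (P : nat -> Prop) :
  (forall m n, ~ P m -> ~ P n -> m = n) ->
  exists M, forall n, (M <= n)%N -> P n.
Proof.
move=> uP; have [[m Pm]|h] := pselect (exists m, ~ P m).
  exists m.+1 => n mn; apply: contrapT => Pn.
  by move: mn; rewrite (uP n m)// ltnn.
by exists 0%N => n _; apply: contrapT => Pn; apply: h; exists n.
Qed.

Lemma eventually_seq (T : eqType) (s : seq T) (P : T -> nat -> Prop) :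
  (forall t, exists M, forall n, (M <= n)%N -> P t n) ->
  exists M, forall n, (M <= n)%N -> forall t, t \in s -> P t n.
Proof.
move=> hP; elim: s => [|t s [M hM]]; first by exists 0%N.
have [M' hM'] := hP t; exists (maxn M M') => n; rewrite geq_max => /andP[Mn M'n] u.
by rewrite inE => /predU1P[->|us]; [exact: hM'|exact: hM].
Qed.

Lemma natr_inj_pchar0 (L : fieldType) : [pchar L] =i pred0 ->
  injective (fun n : nat => n%:R : L).
Proof.
move=> ch; have h (m n : nat) : (m <= n)%N -> m%:R = n%:R :> L -> m = n.
  move=> mn e; have /eqP : (n - m)%:R = 0 :> L by rewrite natrB// e subrr.
  rewrite ((pcharf0P L).1 ch) => nm.
  by apply/eqP; rewrite eqn_leq mn -subn_eq0.
move=> m n /= e; have [mn|/ltnW nm] := leqP m n; first exact: h.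
by apply/esym/h.
Qed.

End Eventually.

Section Dilations.
Variables (R : realType) (L : fieldType).

(** If, for all [n >= 1], the additive convolution of [f] with its dilate by [n]
is proportional to its dilate by [n + 1], then the support of [f] has at most one
point.  The coefficient at [z] of this convolution is the sum over [y] of
[f (z - n y) * f y]. *)
Lemma dilation_stable_support (f : fseries R L) : [pchar L] =i pred0 ->
  abs_summable f ->
  (forall n, exists c, forall z,
     csum (fun y => f (z - n.+1%:R * y) * f y) = c * f (z / n.+2%:R)) ->
  forall x y, x != y -> f x * f y = 0.
Proof.
move=> ch sf hf x0 y0 xy0; apply/eqP; apply: contrapT => /negP ne0.
have nz n : n.+1%:R != 0 :> L by rewrite ((pcharf0P L).1 ch).
have fx0 : f x0 != 0 by apply: contraNneq ne0 => ->; rewrite mul0r.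
have n0 x : 0 <= normc (f x) by exact: normc_ge0.
have tf : has_tsum (fun x => normc (f x)) by rewrite -abs_summableE.
have hH := Hilb_abs_summable sf.
set S := tsum (fun x => normc (f x)).
have fS x : normc (f x) <= S by apply: (tsum_ge_term x).
have S0 : 0 <= S by exact: le_trans (n0 x0) (fS x0).
have conv_sum n z : abs_summable (fun y => f (z - n.+1%:R * y) * f y).
  apply: (@Hilb_mul_summable R L L (fun y => z - n.+1%:R * y) id f f) => //.
  by move=> u v /= /addrI/oppr_inj/(mulfI (nz n)).
set D := S * S / normc (f x0).
have fx0p : 0 < normc (f x0) by rewrite normc_gt0.
have D0 : 0 <= D by rewrite /D divr_ge0 ?mulr_ge0.
(* comparing coefficients at (n + 1) x0 bounds the constants uniformly in n *)
have {}hf n : exists2 c, normc c <= D & forall z,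
     csum (fun y => f (z - n.+1%:R * y) * f y) = c * f (z / n.+2%:R).
  have [c hc] := hf n; exists c => //.
  have := hc (n.+2%:R * x0); rewrite mulrAC mulfV// mul1r => e.
  rewrite /D ler_pdivlMr// -normcM -e.
  apply: le_trans (normc_csum_le (conv_sum _ _)) _.
  rewrite -(tsumZ S0 n0 tf); apply: le_tsum; last exact: has_tsumZ.
    by move=> y; exact: normc_ge0.
  by move=> y; rewrite normcM ler_wpM2r.
set eta := normc (f x0 * f y0).
have eta0 : 0 < eta by rewrite normc_gt0.
pose d := eta / (2 * S + D + 1).
have den0 : 0 < 2 * S + D + 1 by lra.
have d0 : 0 < d by rewrite divr_gt0.
have [A tA Ad] := tsum_tail n0 tf d0.
have v0 y : 0 <= if y \in A then 0 else normc (f y) by case: ifP.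
have fA y : y \notin A -> normc (f y) <= d.
  by move=> /negbTE yA; apply: le_trans Ad; have := tsum_ge_term y v0 tA; rewrite yA.
(* [A] carries all but [d] of the mass of [f]; only finitely many [n] put another
   pair of points (x, y) of [A] on the line x + n y = x0 + n y0, or put the point
   (x0 + n y0) / (n + 1) in [A] *)
have [M1 hM1] : exists M, forall n, (M <= n)%N -> forall p, p \in [seq (y, x) | y <- A, x <- A] ->
    p.1 != y0 -> x0 + n.+1%:R * y0 - n.+1%:R * p.1 != p.2.
  apply: (@eventually_seq _ _ (fun p n => p.1 != y0 ->
     x0 + n.+1%:R * y0 - n.+1%:R * p.1 != p.2)) => -[y x] /=.
  apply: eventually_of_inj => m n /not_implyP[yy0 /negP/negPn/eqP em].
  move=> /not_implyP[_ /negP/negPn/eqP en]; apply: succn_inj.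
  apply: (natr_inj_pchar0 ch) => /=; have u0 : y0 - y != 0 by rewrite subr_eq0 eq_sym.
  apply: (mulIf u0); apply: (addrI x0).
  by rewrite !mulrBr !addrA em en.
have [M2 hM2] : exists M, forall n, (M <= n)%N -> forall w, w \in A ->
    (x0 + n.+1%:R * y0) / n.+2%:R != w.
  apply: (@eventually_seq _ _ (fun w n => (x0 + n.+1%:R * y0) / n.+2%:R != w)) => w.
  have e1 n : (x0 + n.+1%:R * y0) / n.+2%:R = w -> x0 - w = n.+1%:R * (w - y0).
    move=> <-; have := nz n.+1; rewrite -(natr1 n.+1); move: (n.+1%:R) => N hN; by field.
  apply: eventually_of_inj => m n /negP/negPn/eqP/e1 em /negP/negPn/eqP/e1 en.
  have u0 : w - y0 != 0.
    apply: contraNneq xy0 => wy; move: em; rewrite wy mulr0 => /eqP.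
    by rewrite subr_eq0 => /eqP ->; rewrite -subr_eq0 wy.
  apply: succn_inj; apply: (natr_inj_pchar0 ch) => /=; apply: (mulIf u0).
  by rewrite -em.
pose n := maxn M1 M2.
have {}hM1 := hM1 n (leq_maxl _ _); have {}hM2 := hM2 n (leq_maxr _ _).
have [c cD hc] := hf n.
set z := x0 + n.+1%:R * y0.
pose h y := if y == y0 then f x0 * f y0 else 0.
pose g y := if y == y0 then 0 else f (z - n.+1%:R * y) * f y.
have sg : abs_summable g.
  apply: abs_summable_le (_ : has_tsum (fun y => normc (f (z - n.+1%:R * y) * f y))).
    by move=> y; rewrite /g; case: ifP => // _; rewrite normc0 normc_ge0.
  by rewrite -abs_summableE.
have h0 y : y != y0 -> h y = 0 by rewrite /h => /negbTE ->.
have Eh : csum h = f x0 * f y0 by rewrite (csum_support1 h0) /h eqxx.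
have Ec : f x0 * f y0 + csum g = c * f (z / n.+2%:R).
  rewrite -Eh -hc -csumD//; last exact: abs_summable_support1 h0.
  apply: eq_csum => y; rewrite /h /g; case: eqP => [->|_]; rewrite ?add0r// addr0.
  by rewrite /z addrK.
(* each nonzero term of [g] has a factor [f w] with [w] outside [A] *)
have gle : normc (csum g) <= 2 * S * d.
  apply: le_trans (normc_csum_le sg) _.
  have hv := has_tsumZ S0 v0 tA; have hw := has_tsumZ (ltW d0) n0 tf.
  have pv y : 0 <= S * (if y \in A then 0 else normc (f y)) by rewrite mulr_ge0.
  have pw y : 0 <= d * normc (f y) by rewrite mulr_ge0// ltW.
  apply: (@le_trans _ _ (S * d + d * S)); last by lra.
  apply: (@le_trans _ _ (S * tsum (fun y => if y \in A then 0 else normc (f y)) + d * S));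
    last by rewrite lerD2r ler_wpM2l.
  rewrite -(tsumZ S0 v0 tA) -(tsumZ (ltW d0) n0 tf) -tsumD//.
  apply: le_tsum => [y|y|]; [exact: normc_ge0| |exact: has_tsumD].
  rewrite /g; case: (eqVneq y y0) => [_|yy0]; first by rewrite normc0 addr_ge0.
  rewrite normcM; case: ifPn => [yA|yA].
    rewrite mulr0 add0r ler_wpM2r//; apply: fA; apply/negP => xA.
    have := hM1 (y, z - n.+1%:R * y); rewrite eqxx => /(_ _ yy0) hF.
    suff /hF : (y, z - n.+1%:R * y) \in [seq (y, x) | y <- A, x <- A] by [].
    by apply/allpairsP; exists (y, z - n.+1%:R * y).
  by rewrite (le_trans (ler_wpM2r (n0 y) (fS _)))// lerDl.
have fw : normc (f (z / n.+2%:R)) <= d.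
  by apply: fA; apply/negP => /hM2; rewrite eqxx.
have : eta <= D * d + 2 * S * d.
  rewrite /eta; have -> : f x0 * f y0 = c * f (z / n.+2%:R) + - csum g by rewrite -Ec addrK.
  apply: le_trans (normcD_le _ _) _; rewrite normcN lerD//.
  by rewrite normcM ler_pM// normc_ge0.
have : d * (2 * S + D + 1) = eta by rewrite /d mulrVK// unitfE lt0r_neq0.
lra.
Qed.

End Dilations.

(** * Classes of series modulo scalars *)

Section Classes.
Variables (R : realType) (L : fieldType).
Implicit Types a b : fseries R L.

Lemma line_refl a : line a a.
Proof. by exists 1; [exact: oner_neq0|apply/funext => x; rewrite mul1r]. Qed.

Lemma line_scale (c : R[i]) a : c != 0 -> line (fun x => c * a x) = line a.
Proof.
move=> c0; apply/seteqP; split=> b /= [d d0 ->].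
  by exists (d * c); [rewrite mulf_neq0|apply/funext => x; rewrite mulrA].
by exists (d / c); [rewrite mulf_neq0// invr_eq0|apply/funext => x; field].
Qed.

Lemma line_eq a b : line a b -> line b = line a.
Proof. by move=> [c c0 ->]; exact: line_scale. Qed.

Lemma zero_sum0 : zero_sum ((fun=> 0) : fseries R L).
Proof.
split; last exact: csum0.
by apply: (abs_summable_support1 (i0 := 0)).
Qed.

Lemma Nonlin_line a : Hilb a -> ~ zero_sum a -> exists x : @Nonlin R L, val x = line a.
Proof.
move=> ha za; have h : line a \in @Nonlin R L by apply/mem_set; exists a.
by exists (exist _ (line a) h).
Qed.

Lemma PHilb_line a : Hilb a -> a <> (fun=> 0) -> exists p : @PHilb R L, val p = line a.
Proof.
move=> ha a0; have h : line a \in @PHilb R L by apply/mem_set; exists a.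
by exists (exist _ (line a) h).
Qed.

Lemma NonlinP (x : @Nonlin R L) :
  exists a, [/\ Hilb a, ~ zero_sum a, a <> (fun=> 0) & val x = line a].
Proof.
have [a [ha za] <-] := set_mem (valP x); exists a; split=> //.
by move=> a0; apply: za; rewrite a0; exact: zero_sum0.
Qed.

Lemma PHilbP (p : @PHilb R L) a : val p = line a -> Hilb a /\ a <> (fun=> 0).
Proof.
have [b [hb b0] <-] := set_mem (valP p) => e.
have [c c0 ->] : line b a by rewrite e; exact: line_refl.
split; first exact: HilbZ.
move=> cb; apply: b0; apply/funext => x.
by have /eqP := congr1 (fun f => f x) cb; rewrite mulf_eq0 (negbTE c0) => /eqP.
Qed.

Lemma Nonlin_PHilb (x : @Nonlin R L) : exists p : @PHilb R L, val p = val x.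
Proof. by have [a [ha _ a0 ->]] := NonlinP x; exact: PHilb_line. Qed.

Lemma val_line (x : @Nonlin R L) a : val x a -> val x = line a.
Proof. by have [b [_ _ _ ->]] := NonlinP x => /line_eq ->. Qed.

Lemma Nonlin_Hilb (x : @Nonlin R L) a : val x = line a -> Hilb a.
Proof. by have [p <-] := Nonlin_PHilb x => /PHilbP[]. Qed.

Lemma Nonlin_neq0 (x : @Nonlin R L) a : val x = line a -> a <> (fun=> 0).
Proof. by have [p <-] := Nonlin_PHilb x => /PHilbP[]. Qed.

Lemma fs_distE (p q : @PHilb R L) a b : val p = line a -> val q = line b ->
  fs_dist p q = acos (normc (inner a b) / (hnorm a * hnorm b)).
Proof.
move=> pa qb; have [ha a0] := PHilbP pa; have [hb b0] := PHilbP qb.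
have repr (r : @PHilb R L) d : val r = line d -> line d (fs_repr r).
  by move=> rd; rewrite /fs_repr rd; apply: xgetPex; exists d; exact: line_refl.
rewrite /fs_dist; have [c c0 ->] := repr _ _ pa; have [d d0 ->] := repr _ _ qb.
rewrite innerZZ// !hnormZ// !normcM normc_conjc; congr (acos _).
have := hnorm_gt0 ha a0; have := hnorm_gt0 hb b0.
move: c0 d0; rewrite -!normc_gt0 => c0 d0 B0 A0; field.
by rewrite !lt0r_neq0.
Qed.

Lemma fs_dist_eq (p q p' q' : @PHilb R L) a b a' b' : val p = line a -> val q = line b ->
  val p' = line a' -> val q' = line b' -> fs_dist p q = fs_dist p' q' ->
  normc (inner a b) / (hnorm a * hnorm b) = normc (inner a' b') / (hnorm a' * hnorm b').
Proof.
have itv (r s : @PHilb R L) c d : val r = line c -> val s = line d ->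
    normc (inner c d) / (hnorm c * hnorm d) \in `[-1, 1]%R.
  move=> /PHilbP[hc c0] /PHilbP[hd d0].
  have n0 : 0 < hnorm c * hnorm d by rewrite mulr_gt0// hnorm_gt0.
  rewrite in_itv /= ler_pdivrMr// mul1r cauchy_schwarz// andbT.
  apply: (@le_trans _ _ 0); first exact: lerN10.
  by rewrite divr_ge0// ?normc_ge0// ltW.
move=> pa qb pa' qb'; rewrite (fs_distE pa qb) (fs_distE pa' qb') => e.
by rewrite -[LHS](acosK (itv _ _ _ _ pa qb)) e acosK// (itv _ _ _ _ pa' qb').
Qed.

End Classes.

(** * Monomials and their products *)

Section Monomials.
Variables (R : realType) (L : fieldType).
Implicit Types a b f : fseries R L.

(** The monomial rho^x. *)
Definition mono (x : L) : fseries R L := fun y => (y == x)%:R.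

Lemma mono_support x y : y != x -> mono x y = 0.
Proof. by rewrite /mono => /negbTE ->. Qed.

Lemma mono_refl x : mono x x = 1.
Proof. by rewrite /mono eqxx. Qed.

Lemma mono_summable x : abs_summable (mono x).
Proof. exact: abs_summable_support1 (@mono_support x). Qed.

Lemma Hilb_mono x : Hilb (mono x).
Proof. exact/Hilb_abs_summable/mono_summable. Qed.

Lemma line_mono_inj x y : line (mono x) = line (mono y) -> x = y.
Proof.
move=> e; have [c c0 /(congr1 (fun f => f y))] : line (mono x) (mono y).
  by rewrite e; exact: line_refl.
rewrite mono_refl /mono => /eqP h; apply/eqP; apply: contraT => /negbTE xy.
by move: h; rewrite [y == x]eq_sym xy mulr0 oner_eq0.
Qed.

(** The series rho^x + c rho^y. *)
Definition two_term (x y : L) (c : R[i]) : fseries R L := fun z => mono x z + c * mono y z.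

Lemma two_term_summable x y c : abs_summable (two_term x y c).
Proof. by apply: abs_summableD; [|apply: abs_summableZ]; exact: mono_summable. Qed.

Lemma Hilb_two_term x y c : Hilb (two_term x y c).
Proof. exact/Hilb_abs_summable/two_term_summable. Qed.

Lemma csum_mono x : csum (mono x) = 1.
Proof. by rewrite (csum_support1 (@mono_support x)) mono_refl. Qed.

Lemma mono_not_zero_sum x : ~ zero_sum (mono x).
Proof. by move=> [_ /eqP]; rewrite csum_mono oner_eq0. Qed.

Lemma csum_two_term x y c : csum (two_term x y c) = 1 + c.
Proof.
rewrite csumD; [|exact: mono_summable|exact/abs_summableZ/mono_summable].
by rewrite csumZ ?csum_mono ?mulr1//; exact: mono_summable.
Qed.

Lemma two_term_not_zero_sum x y c : 1 + c != 0 -> ~ zero_sum (two_term x y c).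
Proof. by move=> c0 [_ /eqP]; rewrite csum_two_term (negbTE c0). Qed.

Lemma inner_mono a x : inner a (mono x) = a x.
Proof.
rewrite /inner (csum_support1 (i0 := x)) ?mono_refl ?conjc1 ?mulr1//.
by move=> y yx; rewrite mono_support// conjc0 mulr0.
Qed.

Lemma inner_two_term a x y c : inner a (two_term x y c) = a x + conjc c * a y.
Proof.
have s z : abs_summable (fun x => a x * conjc (mono z x)).
  by apply: (abs_summable_support1 (i0 := z)) => t tz; rewrite mono_support// conjc0 mulr0.
rewrite -(inner_mono a x) -(inner_mono a y) /inner -csumZ// -csumD//; last exact: abs_summableZ.
by apply: eq_csum => z; rewrite /two_term rmorphD rmorphM; ring.
Qed.

Lemma cauchy_prodE a b z : cauchy_prod a b z = csum (fun y => a (z - y) * b y).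
Proof.
rewrite /cauchy_prod.
have pr y : (z - y, y).1 + (z - y, y).2 == z by rewrite /= subrK.
pose e y : {p : L * L | p.1 + p.2 == z} := exist _ (z - y, y) (pr y).
have be : bijective e.
  exists (fun p => (val p).2) => [//|[[u v] /= uv]]; apply: val_inj => /=.
  by congr (_, _); rewrite -(eqP uv) addrK.
by rewrite -(csum_reindex (fun p => a (val p).1 * b (val p).2) be).
Qed.

Lemma cauchy_prod_monoZ (c : R[i]) x b :
  cauchy_prod (fun y => c * mono x y) b = (fun z => c * b (z - x)).
Proof.
apply/funext => z; rewrite cauchy_prodE (csum_support1 (i0 := z - x)).
  by rewrite subKr mono_refl mulr1.
move=> y yx; rewrite mono_support ?mulr0 ?mul0r//.
by apply: contraNneq yx => <-; rewrite subKr.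
Qed.

(** In the coefficient at [z] of a Dirichlet product by rho^x, only the pair
[(x, z / x)] contributes. *)
Lemma dirichlet_family_monoZ (c : R[i]) x b z : x != 0 ->
  exists2 p0 : {p : L * L | p.1 * p.2 == z}, val p0 = (x, z / x) &
    forall p, p != p0 -> dirichlet_family (fun y => c * mono x y) b p = 0.
Proof.
move=> x0; have pr : (x, z / x).1 * (x, z / x).2 == z by rewrite /= mulrC divfK.
exists (exist _ (x, z / x) pr) => // -[[u v] /= uv] p0.
rewrite /dirichlet_family /= mono_support ?mulr0 ?mul0r//.
apply: contraNneq p0 => ux; apply/eqP/val_inj => /=; congr (_, _) => //.
by rewrite -(eqP uv) ux mulrAC mulfV// mul1r.
Qed.

Lemma dirichlet_summable_mono x b : x != 0 ->
  abs_summable (@dirichlet_family _ _ (mono x) b 0).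
Proof.
move=> x0; have [p0 _ hp] := dirichlet_family_monoZ 1 b 0 x0.
apply: (abs_summable_support1 (i0 := p0)) => p /hp <-.
by rewrite /dirichlet_family mul1r.
Qed.

Lemma dirichlet_prod_monoZ (c : R[i]) x b : x != 0 ->
  dirichlet_prod (fun y => c * mono x y) b = (fun z => c * b (z / x)).
Proof.
move=> x0; apply/funext => z; have [p0 e hp] := dirichlet_family_monoZ c b z x0.
by rewrite /dirichlet_prod (csum_support1 hp) /dirichlet_family e /= mono_refl mulr1.
Qed.

Lemma dirichlet_family_mono (c d : R[i]) x y z (p : {p : L * L | p.1 * p.2 == z}) :
  dirichlet_family (fun t => c * mono x t) (fun t => d * mono y t) p =
  if val p == (x, y) then c * d else 0.
Proof.
rewrite /dirichlet_family; case: p => -[u v] /= _; rewrite /mono xpair_eqE.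
by case: eqP => _; case: eqP => _; rewrite ?mulr1 ?mulr0 ?mul0r.
Qed.

Lemma dirichlet_prod_mono (c d : R[i]) x y :
  dirichlet_prod (fun t => c * mono x t) (fun t => d * mono y t) =
  (fun t => c * d * mono (x * y) t).
Proof.
apply/funext => z; rewrite /dirichlet_prod (eq_csum (dirichlet_family_mono c d x y (z := z))).
have [zE|zE] := eqVneq (x * y) z; last first.
  rewrite mono_support ?mulr0 1?eq_sym//; apply: csum0 => -[p /= pz].
  by case: eqP => // pE; move: pz; rewrite pE (negbTE zE).
have pr : (x, y).1 * (x, y).2 == z by rewrite /= zE.
rewrite [in RHS]zE mono_refl mulr1 (csum_support1 (i0 := exist _ (x, y) pr)) /= ?eqxx//.
by move=> p; rewrite -val_eqE /= => /negbTE ->.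
Qed.

Lemma dirichlet_summable_mono2 x y :
  abs_summable (@dirichlet_family R L (mono x) (mono y) 0).
Proof.
have e : @dirichlet_family R L (mono x) (mono y) 0 =1
    fun p => if val p == (x, y) then 1 else 0.
  move=> p; have := dirichlet_family_mono 1 1 x y p; rewrite mulr1 => <-.
  by rewrite /dirichlet_family !mul1r.
have [xy0|xy0] := eqVneq (x * y) 0; last first.
  apply: (abs_summable_support1 (i0 := exist _ (0, 0) (introT eqP (mul0r 0)))) => p _.
  rewrite e; case: eqP => // pE; have := valP p.
  by rewrite pE /= (negbTE xy0).
apply: (abs_summable_support1 (i0 := exist _ (x, y) (introT eqP xy0))) => p.
by rewrite e -val_eqE /= => /negbTE ->.
Qed.

(** The pairs [(0, y)] are among those with product 0, so that the convergence
required at exponent 0 makes any Dirichlet factor of rho^0 absolutely summable. *)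
Lemma abs_summable_of_dirichlet0 (c : R[i]) b : c != 0 ->
  abs_summable (@dirichlet_family R L (fun y => c * mono 0 y) b 0) -> abs_summable b.
Proof.
move=> c0 sb; pose e y : {p : L * L | p.1 * p.2 == 0} := exist _ (0, y) (introT eqP (mul0r y)).
have ie : injective e by move=> u v /(congr1 (fun p => (val p).2)).
have := abs_summableZ c^-1 (abs_summable_inj ie sb).
rewrite /dirichlet_family /= mono_refl; congr (abs_summable _); apply/funext => y.
by rewrite mulr1 mulKf.
Qed.

End Monomials.

(** In what follows, the lemmas [is_cauchy_mono], [is_dirichlet_mono] and
[is_dirichlet_mono2] establish a product of classes, and the corresponding lemmas
with suffix [_line] compute the result of a given one. *)

Section PartialOperations.
Variables (R : realType) (L : fieldType).
Implicit Types (x y w : L) (a b d : fseries R L) (X Y Z : @Nonlin R L).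

Lemma shift_bij (x : L) : bijective (fun z : L => z - x).
Proof. by exists (fun z => z + x) => z; rewrite ?subrK ?addrK. Qed.

Lemma div_bij (x : L) : x != 0 -> bijective (fun z : L => z / x).
Proof. by move=> x0; exists (fun z => z * x) => z; rewrite ?divfK ?mulfK. Qed.

Lemma mono_shift x y : (fun z => mono R y (z - x)) = mono R (x + y).
Proof. by apply/funext => z; rewrite /mono subr_eq addrC. Qed.

Lemma mono_div x y : x != 0 -> (fun z => mono R y (z / x)) = mono R (x * y).
Proof.
move=> x0; apply/funext => z; rewrite /mono.
by rewrite -(inj_eq (mulIf x0)) divfK// [y * x]mulrC.
Qed.

Lemma two_term_shift x y w c :
  (fun z => two_term y w c (z - x)) = @two_term R L (x + y) (x + w) c.
Proof. by apply/funext => z; rewrite /two_term -!mono_shift. Qed.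

Lemma two_term_div x y w c : x != 0 ->
  (fun z => two_term y w c (z / x)) = @two_term R L (x * y) (x * w) c.
Proof. by move=> x0; apply/funext => z; rewrite /two_term -!mono_div. Qed.

Lemma is_cauchy_mono x b X Y Z : val X = line (mono R x) -> val Y = line b ->
  val Z = line (fun z => b (z - x)) -> is_cauchy X Y Z.
Proof.
move=> eX eY eZ; exists (mono R x), b.
have e : cauchy_prod (mono R x) b = (fun z => b (z - x)).
  have -> : mono R x = (fun y => 1 * mono R x y) by apply/funext => y; rewrite mul1r.
  by rewrite cauchy_prod_monoZ; apply/funext => z; rewrite mul1r.
split; rewrite ?eX ?eY ?eZ ?e; try exact: line_refl.
rewrite /cauchy_defined e; apply: (Hilb_reindex (shift_bij x)).
exact: Nonlin_Hilb eY.
Qed.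

Lemma is_cauchy_mono_line x b X Y Z : is_cauchy X Y Z -> val X = line (mono R x) ->
  val Y = line b -> val Z = line (fun z => b (z - x)).
Proof.
move=> [a' [b' [+ + _ zab]]] eX eY; rewrite eX eY => -[c c0 ea] [d d0 eb].
rewrite (val_line zab) ea eb cauchy_prod_monoZ -[RHS](line_scale _ (mulf_neq0 c0 d0)).
by congr line; apply/funext => z; rewrite mulrA.
Qed.

Lemma is_dirichlet_mono x b X Y Z : x != 0 -> val X = line (mono R x) -> val Y = line b ->
  val Z = line (fun z => b (z / x)) -> is_dirichlet X Y Z.
Proof.
move=> x0 eX eY eZ; exists (mono R x), b.
have e : dirichlet_prod (mono R x) b = (fun z => b (z / x)).
  have -> : mono R x = (fun y => 1 * mono R x y) by apply/funext => y; rewrite mul1r.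
  by rewrite dirichlet_prod_monoZ//; apply/funext => z; rewrite mul1r.
split; rewrite ?eX ?eY ?eZ ?e; try exact: line_refl.
split; first exact: dirichlet_summable_mono.
rewrite e; apply: (Hilb_reindex (div_bij x0)); exact: Nonlin_Hilb eY.
Qed.

Lemma is_dirichlet_mono_line x b X Y Z : x != 0 -> is_dirichlet X Y Z ->
  val X = line (mono R x) -> val Y = line b -> val Z = line (fun z => b (z / x)).
Proof.
move=> x0 [a' [b' [+ + _ zab]]] eX eY; rewrite eX eY => -[c c0 ea] [d d0 eb].
rewrite (val_line zab) ea eb dirichlet_prod_monoZ// -[RHS](line_scale _ (mulf_neq0 c0 d0)).
by congr line; apply/funext => z; rewrite mulrA.
Qed.

Lemma is_dirichlet_mono2 x y X Y Z : val X = line (mono R x) -> val Y = line (mono R y) ->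
  val Z = line (mono R (x * y)) -> is_dirichlet X Y Z.
Proof.
move=> eX eY eZ; exists (mono R x), (mono R y).
have e : dirichlet_prod (mono R x) (mono R y) = mono R (x * y).
  have h u : mono R u = (fun y => 1 * mono R u y) by apply/funext => t; rewrite mul1r.
  rewrite [mono R x]h [mono R y]h dirichlet_prod_mono.
  by apply/funext => z; rewrite !mul1r.
split; rewrite ?eX ?eY ?eZ ?e; try exact: line_refl.
split; first exact: dirichlet_summable_mono2.
by rewrite e; exact: Hilb_mono.
Qed.

Lemma is_dirichlet_mono2_line x y X Y Z : is_dirichlet X Y Z ->
  val X = line (mono R x) -> val Y = line (mono R y) -> val Z = line (mono R (x * y)).
Proof.
move=> [a' [b' [+ + _ zab]]] eX eY; rewrite eX eY => -[c c0 ea] [d d0 eb].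
by rewrite (val_line zab) ea eb dirichlet_prod_mono (line_scale _ (mulf_neq0 c0 d0)).
Qed.

Lemma is_dirichlet_mono0_summable b X Y Z : is_dirichlet X Y Z ->
  val X = line (mono R (0 : L)) -> val Y = line b -> abs_summable b.
Proof.
move=> [a' [b' [+ + [sab _] _]]] eX eY; rewrite eX eY => -[c c0 ea] [d d0 eb].
rewrite ea eb in sab; have := abs_summableZ d^-1 (abs_summable_of_dirichlet0 c0 sab).
by under eq_fun do rewrite mulKf//.
Qed.

Lemma is_cauchy_line a b d X Y Z : is_cauchy X Y Z ->
  val X = line a -> val Y = line b -> val Z = line d ->
  exists c, forall z, csum (fun y => a (z - y) * b y) = c * d z.
Proof.
move=> [a' [b' [+ + _ +]]] eX eY eZ; rewrite eX eY eZ => -[k1 k10 ea] [k2 k20 eb] [k3 k30 ep].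
have ha := Nonlin_Hilb eX; have hb := Nonlin_Hilb eY.
exists ((k1 * k2)^-1 * k3) => z.
have s : abs_summable (fun y => a (z - y) * b y).
  apply: (@Hilb_mul_summable R L L (fun y => z - y) id a b) => //.
  by move=> u v /= /addrI/oppr_inj.
have := congr1 (fun f => f z) ep; rewrite ea eb cauchy_prodE /= => h.
have k0 : k1 * k2 != 0 by rewrite mulf_neq0.
apply: (mulfI k0); rewrite -(csumZ _ s) !mulrA mulfV// mul1r -h.
by apply: eq_csum => y; rewrite mulrACA -!mulrA.
Qed.

End PartialOperations.

(** * Recovering a series from moduli of inner products *)

Section PhaseRecovery.
Variables (R : realType) (L : fieldType).
Implicit Types F G : fseries R L.

(** By polarization, |u|, |v|, |u + v| and |u - i v| determine u times the
conjugate of v. *)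
Lemma moduli_determine_product (r : R) (u v u' v' : R[i]) :
  normc u = r * normc u' -> normc v = r * normc v' ->
  normc (u + conjc 1 * v) = r * normc (u' + conjc 1 * v') ->
  normc (u + conjc (Complex 0 1) * v) = r * normc (u' + conjc (Complex 0 1) * v') ->
  u * conjc v = Complex (r ^+ 2) 0 * (u' * conjc v').
Proof.
have sq (z z' : R[i]) : normc z = r * normc z' -> normc z ^+ 2 = r ^+ 2 * normc z' ^+ 2.
  by move=> ->; rewrite exprMn.
move=> /sq + /sq + /sq + /sq; rewrite !normc_sqr.
case: u u' v v' => [a b] [a' b'] [c d] [c' d'] /= h1 h2 h3 h4.
by apply: complex_ext => /=; nra.
Qed.

Lemma proportional_of_moduli (r : R) F G : 0 < r -> F <> (fun=> 0) ->
  (forall x, normc (G x) = r * normc (F x)) ->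
  (forall x y, x != y ->
     normc (G x + conjc 1 * G y) = r * normc (F x + conjc 1 * F y)) ->
  (forall x y, x != y ->
     normc (G x + conjc (Complex 0 1) * G y) = r * normc (F x + conjc (Complex 0 1) * F y)) ->
  line F G.
Proof.
move=> r0 /fseries_neq0[y Fy] h1 h2 h3.
have Gy : G y != 0 by rewrite -normc_gt0 h1 mulr_gt0// normc_gt0.
have rn0 : Complex (r ^+ 2) 0 != 0 by rewrite eq_complex /= expf_eq0 /= (gt_eqF r0).
have cFy : conjc (F y) != 0 by rewrite conjc_eq0.
have cGy : conjc (G y) != 0 by rewrite conjc_eq0.
pose k : R[i] := Complex (r ^+ 2) 0 * conjc (F y) / conjc (G y).
have k0 : k != 0 by rewrite !mulf_neq0// invr_eq0.
exists k => //; apply/funext => x.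
have : G x * conjc (G y) = Complex (r ^+ 2) 0 * (F x * conjc (F y)).
  have [->|xy] := eqVneq x y.
    have eJ (z : R[i]) : z * conjc z = Complex (normc z ^+ 2) 0.
      by rewrite normc_sqr; case: z => a b; apply: complex_ext => /=; ring.
    rewrite !eJ h1; apply: complex_ext => /=; ring.
  by apply: moduli_determine_product; [exact: h1|exact: h1|exact: h2|exact: h3].
move=> e; apply: (mulIf cGy); rewrite e /k.
by field.
Qed.

End PhaseRecovery.

(** * Endomorphisms of algebraic extensions *)

Section AlgebraicEndomorphisms.

Lemma algebraic_endo_bij (F E : fieldType) (j : {rmorphism F -> E})
  (s : {rmorphism E -> E}) : algebraic_ext j -> (forall x, s (j x) = j x) ->
  bijective s.
Proof.
move=> alg sj; have sI := fmorph_inj s.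
suff surj y : exists x, s x = y.
  have [t ht] := choice surj.
  by exists t => // x; apply: sI; rewrite ht.
have [p p0 py] := alg y.
have pj0 : map_poly j p != 0 by rewrite map_poly_eq0.
have rt n : root (map_poly j p) (iter n s y).
  elim: n => [//|n IH] /=; rewrite /root in IH *.
  have -> : map_poly j p = map_poly s (map_poly j p).
    by rewrite -map_poly_comp; apply: eq_map_poly => z /=; rewrite sj.
  by rewrite horner_map fmorph_eq0.
(* the orbit of [y] consists of roots of [p], hence is finite, hence a cycle *)
have nu : ~~ uniq (traject s y (size (map_poly j p))).
  apply/negP => us; have := max_poly_roots pj0 _ us.
  rewrite size_traject ltnn => h; have : false by apply: h; apply/allP => _ /trajectP[n _ ->].
  by [].
have [n [m [nm e]]] : exists n m, (n < m)%N /\ iter n s y = iter m s y.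
  have /(uniqPn y)[n [m [nm]]] := nu; rewrite size_traject => msz.
  by rewrite !nth_traject ?(ltn_trans nm)// => e; exists n, m.
have ji : injective (iter n s) by elim: n {nm e} => [//|n IH] u v /= /sI /IH.
exists (iter (m - n).-1 s y); apply: ji.
rewrite -iterS prednK ?subn_gt0// -iterD addnC subnK ?e//; exact: ltnW.
Qed.

End AlgebraicEndomorphisms.

Lemma pchar0_of_rat (L : fieldType) (iQ : {rmorphism rat -> L}) : [pchar L] =i pred0.
Proof. by move=> p; rewrite (fmorph_pchar iQ) pchar_num. Qed.

(** * The field automorphism induced by a nonlinear automorphism *)

Section FieldAutomorphismOfNonlinear.
Variables (R : realType) (K L : fieldType) (j : {rmorphism K -> L}).
Variables (M : set (embedding R L)) (U : @Nonlin R L -> @Nonlin R L).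
Hypothesis charL : [pchar L] =i pred0.
Hypothesis hU : nonlinear_galois_group M j U.
Implicit Types (x y : L) (X Y Z : @Nonlin R L).

Let U_cauchy X Y Z : is_cauchy X Y Z -> is_cauchy (U X) (U Y) (U Z).
Proof. by case: hU => -[_ + _ _]; apply. Qed.

Let U_dirichlet X Y Z : is_dirichlet X Y Z -> is_dirichlet (U X) (U Y) (U Z).
Proof. by case: hU => -[_ _ + _]; apply. Qed.

Let U_fixed a X : val X = line a -> (forall y, a y != 0 -> range j y) -> val (U X) = line a.
Proof.
move=> eX ha; case: hU => _ -> //; exists a => //; rewrite eX; exact: line_refl.
Qed.

Let U_fixed_mono (k : K) X : val X = line (mono R (j k)) -> val (U X) = line (mono R (j k)).
Proof.
move=> eX; apply: U_fixed => // y; rewrite /mono; case: (eqVneq y (j k)) => [->|_]; last by rewrite eqxx.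
by move=> _; exists k.
Qed.

Let E_ex x : exists X : @Nonlin R L, val X = line (mono R x).
Proof. apply: Nonlin_line; [exact: Hilb_mono|exact: mono_not_zero_sum]. Qed.

Lemma image_of_mono x X : val X = line (mono R x) -> exists y, val (U X) = line (mono R y).
Proof.
move=> eX; have [f [hf zf f0 ef]] := NonlinP (U X).
have nz n : n.+1%:R != 0 :> L by rewrite ((pcharf0P L).1 charL).
have sf : abs_summable f.
  have [X0 e0] := E_ex 0.
  have /U_dirichlet h : is_dirichlet X0 X X0.
    by apply: (is_dirichlet_mono2 e0 eX); rewrite mul0r.
  apply: (is_dirichlet_mono0_summable h _ ef).
  by rewrite -(rmorph0 j); apply: U_fixed_mono; rewrite rmorph0.
(* rho^(n+1) is fixed, as [n + 1] comes from [K] *)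
have dil n Y : val Y = line (mono R (n.+1%:R * x)) ->
    val (U Y) = line (fun z => f (z / n.+1%:R)).
  move=> eY; have [Xn en] := E_ex n.+1%:R.
  have /U_dirichlet h : is_dirichlet Xn X Y by apply: is_dirichlet_mono2 eY.
  apply: (is_dirichlet_mono_line (nz n) h _ ef).
  by rewrite -(rmorph_nat j); apply: U_fixed_mono; rewrite rmorph_nat.
have ff : forall u v, u != v -> f u * f v = 0.
  apply: dilation_stable_support => // n.
  have [Y eY] := E_ex (n.+1%:R * x); have [Z eZ] := E_ex (n.+2%:R * x).
  have /U_cauchy h : is_cauchy X Y Z.
    by apply: (is_cauchy_mono eX eY); rewrite mono_shift eZ -[n.+2%:R]nat1r mulrDl mul1r.
  have [c hc] := is_cauchy_line h ef (dil n Y eY) (dil n.+1 Z eZ).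
  exists c => z; rewrite -hc.
  rewrite -(csum_reindex (fun y => f (z - y) * f (y / n.+1%:R))
    (e := fun y => n.+1%:R * y)); last first.
    by exists (fun y => n.+1%:R^-1 * y) => y; rewrite ?mulKf ?mulVKf.
  by apply: eq_csum => y; rewrite [_ * y / _]mulrAC mulfV// mul1r.
have [y fy] := fseries_neq0 f0.
exists y; rewrite ef; suff -> : f = (fun t => f y * mono R y t) by exact: line_scale.
apply/funext => t; have [->|ty] := eqVneq t y; first by rewrite mono_refl mulr1.
rewrite mono_support// mulr0; have /eqP := ff _ _ ty.
by rewrite mulf_eq0 (negbTE fy) orbF => /eqP.
Qed.

Lemma exists_rmorphism : exists s : {rmorphism L -> L},
  (forall k, s (j k) = j k) /\
  (forall x X, val X = line (mono R x) -> val (U X) = line (mono R (s x))).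
Proof.
have [E eE] := choice E_ex; have [s hs] := choice (fun x => image_of_mono (eE x)).
have sE x X : val X = line (mono R x) -> val (U X) = line (mono R (s x)).
  by move=> eX; have -> : X = E x by apply: val_inj; rewrite eX eE.
have sj k : s (j k) = j k.
  by apply: (@line_mono_inj R); rewrite -hs; exact: U_fixed_mono.
have sD x y : s (x + y) = s x + s y.
  apply: (@line_mono_inj R); rewrite -hs -mono_shift.
  apply: (is_cauchy_mono_line (X := U (E x)) (Y := U (E y))) => //.
  by apply/U_cauchy/(is_cauchy_mono (eE x) (eE y)); rewrite mono_shift.
have sM x y : s (x * y) = s x * s y.
  apply: (@line_mono_inj R); rewrite -hs.
  apply: (is_dirichlet_mono2_line (X := U (E x)) (Y := U (E y))) => //.
  exact/U_dirichlet/(is_dirichlet_mono2 (eE x) (eE y)).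
have s1 : s 1 = 1 by rewrite -(rmorph1 j) sj.
have s0 : s 0 = 0 by rewrite -(rmorph0 j) sj.
have sB : zmod_morphism s.
  move=> x y; have : s (x - y) + s y = s x by rewrite -sD subrK.
  by move=> <-; rewrite addrK.
pose aS := GRing.isZmodMorphism.Build L L s sB.
pose mS := GRing.isMonoidMorphism.Build L L s (conj s1 sM).
pose S : {rmorphism L -> L} := HB.pack s aS mS.
by exists S.
Qed.

(** The condition [1 + c != 0] says that rho^x + c rho^y is not of sum zero, hence
defines a point of the nonlinear field. *)
Lemma image_of_two_term (s : {rmorphism L -> L}) (c : R[i]) x y X :
  (forall x X, val X = line (mono R x) -> val (U X) = line (mono R (s x))) ->
  1 + c != 0 -> x != y -> val X = line (two_term x y c) ->
  val (U X) = line (two_term (s x) (s y) c).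
Proof.
move=> hs c0 xy eX; have yx : y - x != 0 by rewrite subr_eq0 eq_sym.
have B_ex (u v : L) : exists Y : @Nonlin R L, val Y = line (two_term u v c).
  by apply: Nonlin_line; [exact: Hilb_two_term|exact: two_term_not_zero_sum].
have [Y01 e01] := B_ex 0 1; have [Y0 e0] := B_ex 0 (y - x).
have [Ex ex] := E_ex x; have [Exy exy] := E_ex (y - x).
have h01 : val (U Y01) = line (two_term 0 1 c).
  apply: U_fixed => // z; rewrite /two_term /mono.
  case: (eqVneq z 0) => [->|_]; first by move=> _; exists 0; rewrite ?rmorph0.
  case: (eqVneq z 1) => [->|_]; first by move=> _; exists 1; rewrite ?rmorph1.
  by rewrite add0r mulr0 eqxx.
have /U_dirichlet h1 : is_dirichlet Exy Y01 Y0.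
  by apply: (is_dirichlet_mono yx exy e01); rewrite two_term_div// mulr0 mulr1.
have syx : s (y - x) != 0 by rewrite fmorph_eq0.
have h0 := is_dirichlet_mono_line syx h1 (hs _ _ exy) h01.
rewrite two_term_div// mulr0 mulr1 in h0.
have /U_cauchy h2 : is_cauchy Ex Y0 X.
  by apply: (is_cauchy_mono ex e0); rewrite two_term_shift addr0 addrC subrK.
have := is_cauchy_mono_line h2 (hs _ _ ex) h0.
by rewrite two_term_shift addr0 rmorphB addrC subrK.
Qed.

(** [G] represents the image of [F]; up to a scalar, it is [F] with exponents moved
by [s]. *)
Lemma image_of_series (s : {rmorphism L -> L}) X F :
  bijective s ->
  (forall x X, val X = line (mono R x) -> val (U X) = line (mono R (s x))) ->
  val X = line F -> exists2 G, val (U X) = line G & line F (G \o s).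
Proof.
move=> bs hs eX; have [G [hG _ G0 eG]] := NonlinP (U X); exists G => //.
have hF := Nonlin_Hilb eX; have F0 := Nonlin_neq0 eX.
case: hU => -[[T [_ isoT _ TU]] _ _] _.
have nF := hnorm_gt0 hF F0; have nG := hnorm_gt0 hG G0.
have key Y h h' : val Y = line h -> val (U Y) = line h' -> h' \o s = h ->
    normc (inner (G \o s) h) = hnorm G / hnorm F * normc (inner F h).
  move=> eY eUY hh.
  have [p ep] := Nonlin_PHilb X; have [q eq] := Nonlin_PHilb Y.
  have := fs_dist_eq (etrans (TU _ _ ep) eG) (etrans (TU _ _ eq) eUY)
    (etrans ep eX) (etrans eq eY) (isoT p q).
  rewrite -(inner_reindex _ _ bs) -(hnorm_reindex h' bs) hh.
  have := hnorm_gt0 (Nonlin_Hilb eY) (Nonlin_neq0 eY); move: (hnorm h) => nh nh0 e.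
  have -> : normc (inner (G \o s) h) =
      normc (inner (G \o s) h) / (hnorm G * nh) * (hnorm G * nh).
    by rewrite divfK// mulf_neq0// lt0r_neq0.
  by rewrite e; field; rewrite !lt0r_neq0.
have sI := bij_inj bs.
have mono_s x : mono R (s x) \o s = mono R x.
  by apply/funext => z; rewrite /mono /= (inj_eq sI).
have bin_s x y c : two_term (s x) (s y) c \o s = @two_term R L x y c.
  by apply/funext => z; rewrite /two_term /mono /= !(inj_eq sI).
have bin c x y : 1 + c != 0 -> x != y -> normc (G (s x) + conjc c * G (s y)) =
    hnorm G / hnorm F * normc (F x + conjc c * F y).
  move=> c0 xy; have [Y eY] : exists Y : @Nonlin R L, val Y = line (two_term x y c).
    by apply: Nonlin_line; [exact: Hilb_two_term|exact: two_term_not_zero_sum].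
  have := key _ _ _ eY (image_of_two_term hs c0 xy eY) (bin_s x y c).
  by rewrite !inner_two_term.
apply: (proportional_of_moduli (r := hnorm G / hnorm F)) => //.
- by rewrite divr_gt0.
- move=> x; have [Y eY] := E_ex x.
  by have := key _ _ _ eY (hs _ _ eY) (mono_s x); rewrite !inner_mono.
- move=> x y; apply: bin; by rewrite eq_complex /= paddr_eq0// oner_eq0.
- move=> x y; apply: bin; by rewrite eq_complex /= addr0 oner_eq0.
Qed.

End FieldAutomorphismOfNonlinear.

Lemma inverse_rmorphism (L : fieldType) (s : {rmorphism L -> L}) : bijective s ->
  exists t : {rmorphism L -> L}, cancel s t /\ cancel t s.
Proof.
move=> [t st ts].
have tB : zmod_morphism t by move=> x y; apply: (can_inj st); rewrite rmorphB !ts.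
have tM : GRing.monoid_morphism t := can2_monoid_morphism st ts.
pose aT := GRing.isZmodMorphism.Build L L t tB.
pose mT := GRing.isMonoidMorphism.Build L L t tM.
pose T : {rmorphism L -> L} := HB.pack t aT mT.
by exists T.
Qed.

(** * Action of a field automorphism on signs *)

Section SignTransport.
Variables (R : realType) (L : fieldType) (M : set (embedding R L)).
Hypothesis choiceM : embedding_choice M.

(** The effect of complex conjugation on the eight pieces of the punctured
plane. *)
Definition flip (p : int * int) : int * int := (p.1, - p.2).

Lemma flipK : involutive flip.
Proof. by move=> [u v]; rewrite /flip /= opprK. Qed.

Lemma piece_conj (z : R[i]) : piece (conjc z) = flip (piece z).
Proof. by case: z => a b; rewrite /piece /flip /= sgzN. Qed.

(** A vector of signs + or -, as occurring in the totally real case. *)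
Definition is_sign_vector (v : M -> int * int) : Prop :=
  forall mu, v mu = (1, 0) \/ v mu = (-1, 0).

(** [f] maps the sign of [x] to the sign of [s x].  In the totally real case a sign
vector need not be the sign of an element, and [f] is moreover required to permute
the components of such vectors as composition with [s] permutes the embeddings. *)
Definition transports (s : L -> L) (f : (M -> int * int) -> (M -> int * int)) : Prop :=
  (forall x, f (sign x) = sign (s x)) /\
  (totally_real R L -> forall v, is_sign_vector v -> forall mu : M,
     exists2 nu : M, (val nu : embedding R L) =1 (fun x => (val mu : embedding R L) (s x))
       & f v mu = v nu).

Lemma transports_ex (s : {rmorphism L -> L}) : exists f, transports s f.
Proof.
have nu_ex (mu : M) : exists nu : M,
    (val nu : embedding R L) =1 (fun x => (val mu : embedding R L) (s x)) \/
    (val nu : embedding R L) =1 (fun x => conjc ((val mu : embedding R L) (s x))).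
  pose mus : embedding R L := (val mu : embedding R L) \o s.
  have [nu [[Mnu e] _]] := choiceM mus.
  exists (exist _ nu (mem_set Mnu)); exact: e.
have [nu hnu] := choice nu_ex.
pose b mu := `[< (val (nu mu) : embedding R L) =1 (fun x => (val mu : embedding R L) (s x)) >].
exists (fun v mu => if b mu then v (nu mu) else flip (v (nu mu))); split.
  move=> x; apply/funext => mu; rewrite /sign /b; case: asboolP => [->//|h].
  case: (hnu mu) => [/h//|->].
  by rewrite piece_conj flipK.
move=> real v hv mu; exists (nu mu).
  case: (hnu mu) => [//|h] x; rewrite h.
  by have := real (val mu) (s x); case: (_ (s x)) => c d /= ->; rewrite oppr0.
by case: ifP => // _; case: (hv (nu mu)) => ->; rewrite /flip /= oppr0.
Qed.

Lemma transports_cancel (s t : L -> L) f g : cancel t s -> transports s f -> transports t g ->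
  forall v, Mho v -> f (g v) = v.
Proof.
move=> ts [f1 f2] [g1 g2] v [[real hv]|[_ [x x0 ->]]]; last by rewrite g1 f1 ts.
apply/funext => mu.
have hgv : is_sign_vector (g v).
  by move=> mu'; have [nu _ ->] := g2 real v hv mu'; exact: hv.
have [nu e1 ->] := f2 real _ hgv mu; have [nu' e2 ->] := g2 real v hv nu.
have [nu0 [_ unu]] := choiceM (val mu).
(* [nu'] and [mu] agree as functions; both are chosen, hence they are equal *)
have -> // : nu' = mu; apply: val_inj.
rewrite -(unu (val mu)); last by split; [exact: set_mem (valP mu)|left].
apply/esym/unu; split; first exact: set_mem (valP nu').
by left => x; rewrite e2 e1 ts.
Qed.

Lemma transports_Mho (s : {rmorphism L -> L}) f v : transports s f -> Mho v -> Mho (f v).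
Proof.
move=> [f1 f2] [[real hv]|[real [x x0 ->]]].
  by left; split => // mu; have [nu _ ->] := f2 real v hv mu; exact: hv.
by right; split => //; exists (s x); rewrite ?fmorph_eq0// f1.
Qed.

Lemma sign_transport (s t : {rmorphism L -> L}) : cancel s t -> cancel t s ->
  exists2 iota : @Mho R L M -> @Mho R L M, bijective iota &
    forall (v : @Mho R L M) x, sign x = val v <-> sign (s x) = val (iota v).
Proof.
move=> st ts; have [f hf] := transports_ex s; have [g hg] := transports_ex t.
pose i (v : @Mho R L M) : @Mho R L M :=
  exist _ (f (val v)) (mem_set (transports_Mho hf (set_mem (valP v)))).
pose i' (v : @Mho R L M) : @Mho R L M :=
  exist _ (g (val v)) (mem_set (transports_Mho hg (set_mem (valP v)))).
exists i.
  exists i' => v; apply: val_inj => /=.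
    by rewrite (transports_cancel st hg hf)//; exact: set_mem (valP v).
  by rewrite (transports_cancel ts hf hg)//; exact: set_mem (valP v).
move=> v x; split=> [e|e]; first by rewrite -hf.1 e.
rewrite -[x in LHS]st -hg.1 e /= (transports_cancel st hg hf)//.
exact: set_mem (valP v).
Qed.

End SignTransport.

(** * Action of a field automorphism on classes of series *)

Section InducedAction.
Variables (R : realType) (L : fieldType).
Implicit Types (a b : fseries R L) (p : set (fseries R L)).

(** The image of a class under the map sending the sum of the a_x rho^x to the sum
of the a_x rho^(s x).  Writing it as a preimage avoids naming the inverse of
[s]. *)
Definition relabel (s : L -> L) p : set (fseries R L) := [set b : fseries R L | p (b \o s)].

Lemma relabel_comp s t p : relabel (s \o t) p = relabel s (relabel t p).
Proof. by []. Qed.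

Lemma relabel_line s t a : cancel s t -> cancel t s -> relabel s (line a) = line (a \o t).
Proof.
move=> st ts; apply/seteqP; split=> b [c c0 e]; exists c => //; apply/funext => x.
  by have := congr1 (fun f => f (t x)) e; rewrite /= ts.
by rewrite e /= st.
Qed.

Variables (s t : {rmorphism L -> L}).
Hypotheses (st : cancel s t) (ts : cancel t s).

Let bs : bijective s. Proof. by exists t. Qed.
Let bt : bijective t. Proof. by exists s. Qed.

Lemma relabel_Nonlin p : @Nonlin R L p -> @Nonlin R L (relabel s p).
Proof.
move=> [a [ha za] <-]; exists (a \o t); last by rewrite (relabel_line a st ts).
split; first exact: Hilb_reindex.
move=> [sa /= ca]; apply: za; split.
  have -> : a = (fun x => (a \o t) (s x)) by apply/funext => x /=; rewrite st.
  exact: (abs_summable_inj (can_inj st)).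
rewrite -(csum_reindex a bt); exact: ca.
Qed.

Lemma relabel_PHilb p : @PHilb R L p -> @PHilb R L (relabel s p).
Proof.
move=> [a [ha a0] <-]; exists (a \o t); last by rewrite (relabel_line a st ts).
split; first exact: Hilb_reindex.
move=> at0; apply: a0; apply/funext => x.
by have := congr1 (fun f => f (s x)) at0; rewrite /= st.
Qed.

Lemma cauchy_prod_comp a b : cauchy_prod (a \o t) (b \o t) = cauchy_prod a b \o t.
Proof.
apply/funext => z; rewrite /= !cauchy_prodE -[RHS](csum_reindex _ bt).
by apply: eq_csum => y /=; rewrite rmorphB.
Qed.

(** [t] maps the pairs of product [z] bijectively to those of product [t z]. *)
Lemma fiber_map z : exists2 e : {q : L * L | q.1 * q.2 == z} -> {q : L * L | q.1 * q.2 == t z},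
  bijective e & forall q, val (e q) = (t (val q).1, t (val q).2).
Proof.
have h1 (q : {q : L * L | q.1 * q.2 == z}) :
    (t (val q).1, t (val q).2).1 * (t (val q).1, t (val q).2).2 == t z.
  by rewrite /= -rmorphM (eqP (valP q)).
have h2 (q : {q : L * L | q.1 * q.2 == t z}) :
    (s (val q).1, s (val q).2).1 * (s (val q).1, s (val q).2).2 == z.
  by rewrite /= -rmorphM (eqP (valP q)) ts.
exists (fun q => exist (fun r : L * L => r.1 * r.2 == t z) _ (h1 q)) => //.
by exists (fun q => exist (fun r : L * L => r.1 * r.2 == z) _ (h2 q)) => q; apply: val_inj; rewrite /= ?st ?ts;
  case: (val q).
Qed.

Lemma dirichlet_prod_comp a b : dirichlet_prod (a \o t) (b \o t) = dirichlet_prod a b \o t.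
Proof.
apply/funext => z; have [e be he] := fiber_map z.
rewrite /= /dirichlet_prod -[RHS](csum_reindex _ be).
by apply: eq_csum => p; rewrite /dirichlet_family he.
Qed.

Lemma dirichlet_summable_comp a b : abs_summable (@dirichlet_family R L a b 0) ->
  abs_summable (@dirichlet_family R L (a \o t) (b \o t) 0).
Proof.
have [e be he] := fiber_map 0.
have cast w : w = 0 -> abs_summable (@dirichlet_family R L a b 0) ->
    abs_summable (@dirichlet_family R L a b w) by move=> ->.
move=> /(cast _ (rmorph0 t))/(abs_summable_inj (bij_inj be)); congr (abs_summable _).
by apply/funext => p; rewrite /dirichlet_family he.
Qed.

Lemma relabel_comp_mem a p : p a -> relabel s p (a \o t).
Proof. by move=> pa; rewrite /relabel /=; have -> : (a \o t) \o s = a by apply/funext => x /=; rewrite st. Qed.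

Lemma induced_map (P : set (set (fseries R L))) : (forall p, P p -> P (relabel s p)) ->
  exists T : P -> P, forall x : P, val (T x) = relabel s (val x).
Proof.
move=> hP; by exists (fun x : P => exist (fun y => y \in P) _ (mem_set (hP _ (set_mem (valP x))))).
Qed.

End InducedAction.

(** * The isomorphism of Galois groups *)

Section NonlinearOfField.
Variables (R : realType) (K L : fieldType) (j : {rmorphism K -> L}).
Variables (M : set (embedding R L)).
Hypothesis choiceM : embedding_choice M.

Lemma relabel_automorphism (s : {rmorphism L -> L}) : bijective s -> (forall k, s (j k) = j k) ->
  exists2 U, nonlinear_galois_group M j U & forall X, val (U X) = relabel s (val X).
Proof.
move=> /inverse_rmorphism[t [st ts]] sj.
have bs : bijective s by exists t.
have bt : bijective t by exists s.
have [U hU] := induced_map (@relabel_Nonlin R L s t st ts).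
have [T hT] := induced_map (@relabel_PHilb R L s t st ts).
have [T' hT'] := induced_map (@relabel_PHilb R L t s ts st).
have TT' : cancel T T'.
  move=> p; apply: val_inj; rewrite hT' hT -relabel_comp.
  by have -> : t \o s = id by apply/funext => x /=; rewrite st.
have T'T : cancel T' T.
  move=> p; apply: val_inj; rewrite hT hT' -relabel_comp.
  by have -> : s \o t = id by apply/funext => x /=; rewrite ts.
exists U => //; split; [split|].
- exists T; split.
  + by exists T'.
  + move=> p q; have [a [_ _] pa] := set_mem (valP p); have [b [_ _] qb] := set_mem (valP q).
    have pa' : val (T p) = line (a \o t) by rewrite hT -pa (relabel_line a st ts).
    have qb' : val (T q) = line (b \o t) by rewrite hT -qb (relabel_line b st ts).
    rewrite (fs_distE pa' qb') (fs_distE (esym pa) (esym qb)).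
    by rewrite inner_reindex// !hnorm_reindex.
  + have [iota biota hiota] := sign_transport choiceM st ts.
    exists iota => // v; apply/seteqP; split.
      move=> _ [p [a [ha sa] pa] <-]; exists (a \o t); last by rewrite hT pa (relabel_line a st ts).
      split; first exact: Hilb_reindex.
      move=> x /= /sa[tx0 /(hiota v _).1]; rewrite ts => ->; split => //.
      by apply: contraNneq tx0 => ->; rewrite rmorph0.
    move=> q [b [hb sb] qb]; exists (T' q) => //.
    exists (b \o s); last by rewrite hT' qb (relabel_line b ts st).
    split; first exact: Hilb_reindex.
    move=> x /= /sb[sx0 /(hiota v _).2 ->]; split => //.
    by apply: contraNneq sx0 => ->; rewrite rmorph0.
  + by move=> p x e; rewrite hT hU e.
- move=> X Y Z [a [b [Xa Yb hab Zab]]]; exists (a \o t), (b \o t).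
  rewrite /cauchy_defined (cauchy_prod_comp st ts) !hU.
  by split; [exact: relabel_comp_mem|exact: relabel_comp_mem|exact: Hilb_reindex|exact: relabel_comp_mem].
- move=> X Y Z [a [b [Xa Yb [sab hab] Zab]]]; exists (a \o t), (b \o t).
  rewrite /dirichlet_defined (dirichlet_prod_comp st ts) !hU.
  split; [exact: relabel_comp_mem|exact: relabel_comp_mem| |exact: relabel_comp_mem].
  by split; [exact: dirichlet_summable_comp ts _ _ sab|exact: Hilb_reindex].
- move=> X [a Xa ja]; apply: val_inj; rewrite hU (val_line Xa) (relabel_line a st ts).
  congr line; apply/funext => y /=.
  have tj k : t (j k) = j k by rewrite -[in LHS]sj st.
  have [y0|/ja[k _ <-]] := eqVneq (a y) 0; last by rewrite tj.
  have [->//|/ja[k _ e]] := eqVneq (a (t y)) 0.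
  by rewrite -e -sj e ts.
Qed.

Lemma automorphism_relabel U : [pchar L] =i pred0 -> algebraic_ext j ->
  nonlinear_galois_group M j U ->
  exists2 s, galois_group j s & forall X, val (U X) = relabel s (val X).
Proof.
move=> ch alg hU; have [s [sj hs]] := exists_rmorphism ch hU.
have bs := algebraic_endo_bij alg sj.
exists s; first by exists s.
move=> X; have [a [_ _ _ Xa]] := NonlinP X.
have [G -> [c c0 e]] := image_of_series hU bs hs Xa.
have [t [st ts]] := inverse_rmorphism bs.
rewrite Xa (relabel_line a st ts) -[RHS](line_scale _ c0); congr line; apply/funext => x /=.
by have := congr1 (fun f => f (t x)) e; rewrite /= ts.
Qed.

Lemma relabel_inj (s t : L -> L) : bijective s ->
  (forall X : @Nonlin R L, relabel s (val X) = relabel t (val X)) -> s = t.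
Proof.
move=> bs h; apply/funext => x; have sI := bij_inj bs.
have [X eX] := Nonlin_line (@Hilb_mono R L x) (@mono_not_zero_sum R L x).
have : relabel s (val X) (mono R (s x)).
  rewrite eX /relabel /=; have -> : mono R (s x) \o s = mono R x; last exact: line_refl.
  by apply/funext => z; rewrite /mono /= (inj_eq sI).
rewrite h eX /relabel /= => -[c c0 /(congr1 (fun f => f x))].
rewrite /= mono_refl mulr1 /mono => e.
by move: c0; rewrite -e; case: (eqVneq (t x) (s x)) => [->|]; rewrite ?eqxx.
Qed.

Lemma galois_group_transformation : transformation_group (galois_group j).
Proof.
split.
- by exists idfun; split=> //; exists id.
- move=> _ _ [f [-> bf fj]] [g [-> bg gj]]; exists (f \o g); split=> //.
    exact: bij_comp.
  by move=> x /=; rewrite gj fj.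
- move=> _ [f [-> bf fj]]; have [t [ft tf]] := inverse_rmorphism bf.
  exists t; first exists t; split=> //.
  + by exists f.
  + by move=> x; rewrite -[in LHS]fj ft.
  + by apply/funext => x /=; rewrite tf.
  + by apply/funext => x /=; rewrite ft.
Qed.

End NonlinearOfField.

Theorem theorem9 (R : realType) (L K : fieldType)
  (iQ : {rmorphism rat -> L}) (j : {rmorphism K -> L})
  (galLQ : galois_ext iQ) (galLK : galois_ext j)
  (M : set (embedding R L)) (choiceM : embedding_choice M) :
  group_isomorphic (nonlinear_galois_group M j) (galois_group j).
Proof.
have ch := pchar0_of_rat iQ; case: galLK => alg _ _.
set G := nonlinear_galois_group M j; set H := galois_group j.
have toG s : H s -> exists2 U, G U & forall X, val (U X) = relabel s (val X).
  by move=> [f [-> bf fj]]; exact: relabel_automorphism.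
have toH U : G U -> exists2 s, H s & forall X, val (U X) = relabel s (val X).
  exact: automorphism_relabel.
have inj s s' : H s -> (forall X : @Nonlin R L, relabel s (val X) = relabel s' (val X)) -> s = s'.
  by move=> [f [-> bf _]]; exact: relabel_inj.
have [H1 HM HV] : transformation_group H := galois_group_transformation j.
have Geq U V : (forall X, val (U X) = val (V X)) -> U = V :> (@Nonlin R L -> @Nonlin R L).
  by move=> UV; apply/funext => X; exact/val_inj.
have GofH s U : H s -> (forall X, val (U X) = relabel s (val X)) -> G U.
  move=> Hs hU; have [V GV hV] := toG s Hs.
  by rewrite (Geq U V)// => X; rewrite hU hV.
split=> //.
- split.
  + exact: (GofH id).
  + move=> U V /toH[s Hs hs] /toH[s' Hs' hs'].
    by apply: (GofH (s \o s')) => [|X]; [exact: HM|rewrite /= hs hs'].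
  + move=> U /toH[s Hs hs]; have [t Ht [st ts]] := HV s Hs.
    have [V GV hV] := toG t Ht; exists V => //.
    by split; apply: Geq => X /=; rewrite ?hs ?hV ?hs -relabel_comp ?st ?ts.
- have Phi_ex U : exists s, G U -> H s /\ forall X, val (U X) = relabel s (val X).
    have [/toH[s Hs hs]|nG] := pselect (G U); first by exists s.
    by exists id => /nG.
  have [Phi hPhi] := choice Phi_ex.
  have PhiE U s : G U -> (forall X, val (U X) = relabel s (val X)) -> Phi U = s.
    by move=> /hPhi[HU hU] hs; apply: inj => // X; rewrite -hU hs.
  exists Phi; split; first split.
  + by move=> U /hPhi[].
  + move=> U V /set_mem/hPhi[_ hU] /set_mem/hPhi[_ hV] e.
    by apply: Geq => X; rewrite hU hV e.
  + move=> s /toG[U GU hU]; exists U => //; exact: PhiE.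
  + move=> U V GU GV; have [HU hU] := hPhi U GU; have [HV' hV] := hPhi V GV.
    have hUV X : val ((U \o V) X) = relabel (Phi U \o Phi V) (val X) by rewrite /= hU hV.
    by apply: PhiE => //; apply: (GofH (Phi U \o Phi V)) => //; exact: HM.
Qed.
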